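(* Let $\delta\ge0$ and let $\Phi\colon V\to W(\delta)$ be a morphism of persistence modules which is part of a $\delta$-interleaving pair between $V$ and $W$. Let $q\in\mathbb{R}_{\ge0}$ and fix $q$-splittings of $V$ and $W$. 1. If $\delta<\frac12\min(\Xi(V),\Xi(W_{\ge q}))-\frac q2$, then the morphism $\varphi^W_{\ge q}(\delta)\circ\Phi\colon V\to W_{\ge q}(\delta+\frac q2)$ decomposes as a ladder persistence module. 2. If $\delta<\frac12\min(\Xi(V_{\ge q}),\Xi(W))-\frac q2$, then the morphism $\Phi(\frac q2)\circ\tilde\varphi^V_{\ge q}\colon V_{\ge q}\to W(\delta+\frac q2)$ decomposes as a ladder persistence module. 3. If $\delta<\frac12\min(\Xi(V_{\ge q}),\Xi(W_{\ge q}))-\frac q2$, then the morphism $\tilde\Phi=\varphi^W_{\ge q}(\delta)\circ\Phi\circ i^V_{\ge q}\colon V_{\ge q}\to W_{\ge q}(\delta+\frac q2)$ decomposes as a ladder persistence module. All these decompositions are obtained in partial barcode bases that can be extended to barcode bases of the modules $V$ and $W$.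
   Context: Fix a field $\mathbb{F}$. A persistence module $V$ is a functor from $(\mathbb{R},\le)$ to $\mathbb{F}$-vector spaces, with inner morphisms $v_{s,t}\colon V_s\to V_t$ for $s\le t$, that is isomorphic to a finite direct sum of interval modules $k_J$, where $J=[i,j]$, $i\le j$, is a closed bounded interval and $k_J$ is $\mathbb{F}$ at indices in $J$, $0$ elsewhere, with identity inner morphisms inside $J$. The multiset of intervals in this decomposition is the barcode $\mathbf{Bar}(V)$; its elements are bars. The length of $J=[i,j]$ is $|J|=j-i$. A morphism $\Phi\colon V\to W$ is a family of linear maps $\Phi_t\colon V_t\to W_t$ commuting with inner morphisms. The shift $V(\delta)$ is given by $V(\delta)_t=V_{t+\delta}$, $v(\delta)_{s,t}=v_{s+\delta,t+\delta}$; a morphism $f\colon V\to W$ has shift $f(\delta)\colon V(\delta)\to W(\delta)$, $f(\delta)_t=f_{t+\delta}$. For $\delta\ge 0$, $[\delta]\colon V\to V(\delta)$ denotes the morphism given by the inner morphisms $v_{t,t+\delta}$. A $\delta$-interleaving pair between $V$ and $W$ is a pair of morphisms $\Phi\colon V\to W(\delta)$, $\Psi\colon W\to V(\delta)$ with $\Psi_{t+\delta}\circ\Phi_t=v_{t,t+2\delta}$ and $\Phi_{t+\delta}\circ\Psi_t=w_{t,t+2\delta}$ for all $t$. Relations on intervals: $[i_1,j_1]\preceq[i_2,j_2]$ iff $i_1\le i_2\le j_1\le j_2$; $[i_1,j_1]\subset[i_2,j_2]$ (strictly nested) iff $i_2<i_1\le j_1<j_2$. Nestedness: $\Xi(V)=\min\{\min(|a-c|,|b-d|)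 : [a,b]\subset[c,d],\ [a,b],[c,d]\in\mathbf{Bar}(V)\}\in(0,\infty]$, equal to $\infty$ if there are no strictly nested bars. A $q$-splitting of $V$ is an isomorphism $V\cong V_{\ge q}\oplus V_{<q}$ where all bars of $V_{\ge q}$ have length at least $q$ and all bars of $V_{<q}$ have length smaller than $q$. It induces a projection $pr^V_{\ge q}\colon V\to V_{\ge q}$ and an inclusion $i^V_{\ge q}\colon V_{\ge q}\to V$. Put $$\varphi^V_{\ge q}=[\tfrac q2]\circ pr^V_{\ge q}\colon V\to V_{\ge q}(\tfrac q2),\qquad \tilde\varphi^V_{\ge q}=i^V_{\ge q}(\tfrac q2)\circ[\tfrac q2]\colon V_{\ge q}\to V(\tfrac q2),$$ and similarly for $W$. A barcode basis of $V$ is a finite collection of bar generators $x_J=\{(x_J)_t\in V_t\}_{t\in J}$, one for each bar $J$ of $\mathbf{Bar}(V)$ counted with multiplicity, such that for each $t$ the vectors $(x_J)_t$ with $J\ni t$ form a basis of $V_t$, and $v_{s,t}$ sends $(x_J)_s$ to $(x_J)_t$ if $t\in J$ and to $0$ otherwise. Shifting identifies barcode bases of $V$ and of $V(\delta)$. A barcode basis $\mathcal B$ of $V_{\ge q}$ extends to a barcode basis of $V$ if some barcode basis of $V$ contains $i^V_{\ge q}(\mathcal B)$ (and similarly for $W$). A ladder persistence module is a triple $(V,W,\Phi)$ with $\Phi\colon V\to W$ a morphism; isomorphisms are pairs of isomorphisms of the domains and codomains commuting with the morphisms; direct sums are componentwise. For $J_1\preceq J_2$, $\mathbf{R}_{J_1}^{J_2}=(k_{J_2},k_{J_1},\rho)$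 with $\rho_t=\mathrm{id}$ for $t\in J_1\cap J_2$ and $0$ otherwise; $\mathbf{I}^+_J=(k_J,0,0)$; $\mathbf{I}^-_K=(0,k_K,0)$. A morphism decomposes as a ladder persistence module if the triple (domain, codomain, morphism) is isomorphic to a finite direct sum of modules of the form $\mathbf{R}_{J_1}^{J_2}$, $\mathbf{I}^+_J$, $\mathbf{I}^-_K$. Such an isomorphism corresponds to a choice of barcode bases of the domain and codomain (those in which the decomposition is obtained): in these bases each bar generator of the domain is sent either to a single bar generator of the codomain or to $0$, with distinct generators not sent to the same nonzero generator. *)

(* Defs.v *)
From HB Require Import structures.
From mathcomp Require Import all_boot all_order all_algebra.
From mathcomp Require Import boolp classical_sets reals constructive_ereal.
Set Implicit Arguments.
Unset Strict Implicit.
Unset Printing Implicit Defensive.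
Import Order.TTheory GRing.Theory Num.Theory.
Local Open Scope ring_scope.

(** ** Closed bounded intervals *)

Definition bar (R : realType) := {p : R * R | p.1 <= p.2}.

Section Bars.
Variable R : realType.
Implicit Types (J K : bar R) (t : R).

Definition blo J : R := (val J).1.
Definition bhi J : R := (val J).2.
Definition in_bar J t : bool := blo J <= t <= bhi J.
Definition blen J : R := bhi J - blo J.

Definition bprec J K : bool := [&& blo J <= blo K, blo K <= bhi J & bhi J <= bhi K].

Definition bnested J K : bool := [&& blo K < blo J, blo J <= bhi J & bhi J < bhi K].

Lemma bshift_proof J (d : R) : (blo J - d, bhi J - d).1 <= (blo J - d, bhi J - d).2.
Proof. by rewrite /= lerD2r; exact: (valP J). Qed.

(* [J - d], the interval such that [t] is in it iff [t + d] is in [J]. *)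
Definition bshift (d : R) J : bar R := exist _ (blo J - d, bhi J - d) (bshift_proof J d).

Lemma in_bar_convex J s t u :
  s <= t -> t <= u -> in_bar J s -> in_bar J u -> in_bar J t.
Proof.
move=> st tu /andP[js _] /andP[_ uj].
by rewrite /in_bar (le_trans js st) (le_trans tu uj).
Qed.

End Bars.

(** ** Functors from (R, <=) to F-vector spaces *)

Record pfunctor (R : realType) (F : fieldType) := PFunctor {
  pf_sp :> R -> lmodType F;
  pf_map : forall s t : R, s <= t -> {linear pf_sp s -> pf_sp t};
  pf_id : forall (t : R) (h : t <= t) x, pf_map h x = x;
  pf_comp : forall (s t u : R) (st : s <= t) (tu : t <= u) (su : s <= u) x,
    pf_map su x = pf_map tu (pf_map st x)
}.

Record pf_hom (R : realType) (F : fieldType) (V W : pfunctor R F) := Hom {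
  hom_map :> forall t : R, {linear V t -> W t};
  hom_nat : forall (s t : R) (st : s <= t) x,
    hom_map t (pf_map V st x) = pf_map W st (hom_map s x)
}.

Record pf_iso (R : realType) (F : fieldType) (V W : pfunctor R F) := Iso {
  iso_fwd : pf_hom V W;
  iso_bwd : pf_hom W V;
  iso_fwdK : forall t, cancel (iso_fwd t) (iso_bwd t);
  iso_bwdK : forall t, cancel (iso_bwd t) (iso_fwd t)
}.

Section Constructions.
Variables (R : realType) (F : fieldType).
Implicit Types (V W U : pfunctor R F) (J K : bar R).

Definition hom_comp V W U (g : pf_hom W U) (f : pf_hom V W) : pf_hom V U.
Proof.
refine (@Hom R F V U (fun t => (g t \o f t : {linear V t -> U t})) _).
by move=> s t st x /=; rewrite !hom_nat.
Defined.

Definition pf0 : pfunctor R F.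
Proof.
exact: (@PFunctor R F (fun _ => 'rV[F]_0)
          (fun _ _ _ => (idfun : {linear 'rV[F]_0 -> 'rV[F]_0}))).
Defined.

Definition hom0 V W : pf_hom V W.
Proof.
refine (@Hom R F V W (fun t => (\0 : {linear V t -> W t})) _).
by move=> s t st x /=; rewrite linear0.
Defined.

Lemma pid_mx_bool_comp (a b c : bool) (x : 'rV[F]_a) : (a -> c -> b) ->
  x *m (pid_mx 1 : 'M_(a, c)) = x *m (pid_mx 1 : 'M_(a, b)) *m pid_mx 1.
Proof.
rewrite -mulmxA mul_pid_mx.
case: a x => x; last by rewrite !(thinmx0 x) !mul0mx.
case: c; last by move=> _; apply/matrixP => i [].
by move=> /(_ isT isT) ->.
Qed.

(* The value of k_J at t is F^1 if t is in J and F^0 otherwise; the matrix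
   [pid_mx 1] is the identity of F^1, and is zero as soon as one of the two
   dimensions is 0. *)
Definition kint J : pfunctor R F.
Proof.
refine (@PFunctor R F (fun t => 'rV[F]_(in_bar J t))
  (fun s t _ => (mulmxr (pid_mx 1) :
      {linear 'rV[F]_(in_bar J s) -> 'rV[F]_(in_bar J t)})) _ _).
- move=> t _; rewrite /=; case: (in_bar J t) => x; first by rewrite pid_mx_1 mulmx1.
  by rewrite !thinmx0.
- move=> s t u st tu _ x; apply: pid_mx_bool_comp.
  exact: in_bar_convex.
Defined.

Definition kint_rho J K (JK : bprec J K) : pf_hom (kint K) (kint J).
Proof.
refine (@Hom R F (kint K) (kint J) (fun t => (mulmxr (pid_mx 1) :
      {linear 'rV[F]_(in_bar K t) -> 'rV[F]_(in_bar J t)})) _).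
move=> s t st x; rewrite /= -pid_mx_bool_comp; first rewrite -pid_mx_bool_comp //.
- case/and3P: JK => jk _ _ /andP[ks _] /andP[_ tj].
  by rewrite /in_bar (le_trans jk ks) (le_trans st tj).
- case/and3P: JK => _ _ jk /andP[ks _] /andP[_ tj].
  by rewrite /in_bar (le_trans ks st) (le_trans tj jk).
Defined.

Definition dsum_map (A A' B B' : lmodType F)
  (f : {linear A -> A'}) (g : {linear B -> B'}) (x : A * B) : A' * B' :=
  (f x.1, g x.2).

Lemma dsum_map_is_linear (A A' B B' : lmodType F)
  (f : {linear A -> A'}) (g : {linear B -> B'}) : linear (dsum_map f g).
Proof. by move=> a x y; rewrite /dsum_map /= !linearP. Qed.

HB.instance Definition _ (A A' B B' : lmodType F)
  (f : {linear A -> A'}) (g : {linear B -> B'}) :=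
  GRing.isLinear.Build F (A * B)%type (A' * B')%type _ (dsum_map f g)
    (dsum_map_is_linear f g).

Definition inl_map (A B : lmodType F) (x : A) : A * B := (x, 0).

Lemma inl_map_is_linear (A B : lmodType F) : linear (@inl_map A B).
Proof. by move=> a x y; congr pair; rewrite /= scaler0 addr0. Qed.

HB.instance Definition _ (A B : lmodType F) :=
  GRing.isLinear.Build F A (A * B)%type _ (@inl_map A B) (@inl_map_is_linear A B).

Definition dsum V W : pfunctor R F.
Proof.
refine (@PFunctor R F (fun t => (V t * W t)%type)
  (fun s t st => (dsum_map (pf_map V st) (pf_map W st) :
     {linear (V s * W s)%type -> (V t * W t)%type})) _ _).
- by move=> t h [x y]; rewrite /= /dsum_map /= !pf_id.
- by move=> s t u st tu su [x y]; rewrite /= /dsum_map /= -!pf_comp.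
Defined.

Definition dsum_hom V W V' W' (f : pf_hom V V') (g : pf_hom W W') :
  pf_hom (dsum V W) (dsum V' W').
Proof.
refine (@Hom R F (dsum V W) (dsum V' W') (fun t => (dsum_map (f t) (g t) :
     {linear (V t * W t)%type -> (V' t * W' t)%type})) _).
by move=> s t st [x y]; rewrite /= /dsum_map /= !hom_nat.
Defined.

Definition dsum_fst V W : pf_hom (dsum V W) V.
Proof.
by refine (@Hom R F (dsum V W) V
  (fun t => (fst : {linear (V t * W t)%type -> V t})) _).
Defined.

Definition dsum_inl V W : pf_hom V (dsum V W).
Proof.
refine (@Hom R F V (dsum V W)
  (fun t => (@inl_map (V t) (W t) : {linear V t -> (V t * W t)%type})) _).
by move=> s t st x; rewrite /= /dsum_map /inl_map /= linear0.
Defined.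

Definition interval_sum (s : seq (bar R)) : pfunctor R F :=
  foldr (fun J V => dsum (kint J) V) pf0 s.

(** ** Shifts *)

Lemma pf_square V (s t t' u : R) (st : s <= t) (tu : t <= u)
    (st' : s <= t') (tu' : t' <= u) x :
  pf_map V tu (pf_map V st x) = pf_map V tu' (pf_map V st' x).
Proof.
have su := le_trans st tu.
by rewrite -(pf_comp st tu su) -(pf_comp st' tu' su).
Qed.

Lemma le_shift (d s t : R) : s <= t -> s + d <= t + d.
Proof. by rewrite lerD2r. Qed.

Lemma le_inner (d : R) (hd : 0 <= d) t : t <= t + d.
Proof. by rewrite lerDl. Qed.

Definition pf_shift V (d : R) : pfunctor R F.
Proof.
refine (@PFunctor R F (fun t => V (t + d))
  (fun s t st => pf_map V (le_shift d st)) _ _).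
- by move=> t h x; rewrite pf_id.
- by move=> s t u st tu su x; apply: pf_comp.
Defined.

Definition shift_hom V W (f : pf_hom V W) (d : R) : pf_hom (pf_shift V d) (pf_shift W d).
Proof.
refine (@Hom R F (pf_shift V d) (pf_shift W d) (fun t => f (t + d)) _).
by move=> s t st x; exact: (hom_nat f (le_shift d st) x).
Defined.

(* The morphism [d] : V -> V(d). *)
Definition pf_inner V (d : R) (hd : 0 <= d) : pf_hom V (pf_shift V d).
Proof.
refine (@Hom R F V (pf_shift V d) (fun t => pf_map V (le_inner hd t)) _).
by move=> s t st x; exact: (@pf_square V s t (s + d) (t + d)).
Defined.

Lemma shift_shift_le (a b c : R) (abc : a + b = c) (t : R) : t + b + a <= t + c.
Proof. by rewrite -abc -addrA [b + a]addrC. Qed.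

(* The identification of V(a)(b) with V(a + b): the spaces at t are
   V_{t + b + a} and V_{t + (a + b)}, whose indices are equal but not
   convertible, so it is given by the inner morphism between them. *)
Definition shift_shift V (a b c : R) (abc : a + b = c) :
  pf_hom (pf_shift (pf_shift V a) b) (pf_shift V c).
Proof.
refine (@Hom R F (pf_shift (pf_shift V a) b) (pf_shift V c)
  (fun t => pf_map V (shift_shift_le abc t)) _).
by move=> s t st x; exact: (@pf_square V (s + b + a) (t + b + a) (s + c) (t + c)).
Defined.

End Constructions.

(** ** Persistence modules and barcodes *)

Record persmod (R : realType) (F : fieldType) := PersMod {
  pm_pf :> pfunctor R F;
  pm_dec : exists s : seq (bar R), inhabited (pf_iso pm_pf (interval_sum F s))
}.

Section Persistence.
Variables (R : realType) (F : fieldType).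
Implicit Types (V W : persmod R F) (J K : bar R).

(* A sequence of bars stands for a multiset; the choice of the sequence is
   irrelevant up to permutation, by uniqueness of interval decompositions. *)
Definition Bar V : seq (bar R) :=
  xget [::] [set s | inhabited (pf_iso V (interval_sum F s))]%classic.

Lemma BarP V : inhabited (pf_iso V (interval_sum F (Bar V))).
Proof.
by case: (pm_dec V) => s hs; apply: (@xgetPex _ [::]
  [set s | inhabited (pf_iso V (interval_sum F s))]%classic); exists s.
Qed.

Definition nestedness V : \bar R :=
  \big[mine/+oo%E]_(J <- Bar V) \big[mine/+oo%E]_(K <- Bar V | bnested J K)
    (Num.min `|blo J - blo K| `|bhi J - bhi K|)%:E.

Lemma le_inner2 (d : R) (hd : 0 <= d) t : t <= t + d + d.
Proof. by rewrite (le_trans (le_inner hd t)) ?le_inner. Qed.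

Definition interleaving V W (d : R) (hd : 0 <= d)
  (Phi : pf_hom V (pf_shift W d)) (Psi : pf_hom W (pf_shift V d)) : Prop :=
  (forall t (x : V t), Psi (t + d) (Phi t x) = pf_map V (le_inner2 hd t) x) /\
  (forall t (y : W t), Phi (t + d) (Psi t y) = pf_map W (le_inner2 hd t) y).

Record qsplitting V (q : R) := QSplitting {
  sp_ge : persmod R F;
  sp_lt : persmod R F;
  sp_iso : pf_iso V (dsum sp_ge sp_lt);
  sp_geP : {in Bar sp_ge, forall J, q <= blen J};
  sp_ltP : {in Bar sp_lt, forall J, blen J < q}
}.

Section Splitting.
Variables (V : persmod R F) (q : R) (hq : 0 <= q) (S : qsplitting V q).

Definition sp_pr : pf_hom V (sp_ge S) :=
  hom_comp (dsum_fst (sp_ge S) (sp_lt S)) (iso_fwd (sp_iso S)).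

Definition sp_in : pf_hom (sp_ge S) V :=
  hom_comp (iso_bwd (sp_iso S)) (dsum_inl (sp_ge S) (sp_lt S)).

Lemma half_ge0 : 0 <= q / 2.
Proof. by rewrite divr_ge0. Qed.

Definition sp_phi : pf_hom V (pf_shift (sp_ge S) (q / 2)) :=
  hom_comp (pf_inner (sp_ge S) half_ge0) sp_pr.

Definition sp_phit : pf_hom (sp_ge S) (pf_shift V (q / 2)) :=
  hom_comp (shift_hom sp_in (q / 2)) (pf_inner (sp_ge S) half_ge0).

End Splitting.

(** ** Barcode bases *)

(* A bar together with a generator; the generator is indexed by all of R,
   with the convention that it vanishes outside the bar, which makes the
   compatibility with inner morphisms a single equation. *)
Definition bar_gen (V : pfunctor R F) : Type := (bar R * (forall t, V t))%type.

Definition barcode_basis V (B : seq (bar_gen V)) : Prop :=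
  let x (k : 'I_(size B)) := tnth (in_tuple B) k in
  [/\ perm_eq (unzip1 B) (Bar V),
      forall k t, ~~ in_bar (x k).1 t -> (x k).2 t = 0,
      forall k s t (st : s <= t), in_bar (x k).1 s ->
        pf_map V st ((x k).2 s) = (x k).2 t
    & forall t,
        (forall c : 'I_(size B) -> F,
           \sum_(k | in_bar (x k).1 t) c k *: (x k).2 t = 0 ->
           forall k, in_bar (x k).1 t -> c k = 0) /\
        (forall v : V t, exists c : 'I_(size B) -> F,
           v = \sum_(k | in_bar (x k).1 t) c k *: (x k).2 t)].

Definition gen_push (V W : pfunctor R F) (f : pf_hom V W) (x : bar_gen V) :
  bar_gen W := (x.1, fun t => f t (x.2 t)).

(* Generators of V seen as generators of V(d). *)
Definition gen_shift (V : pfunctor R F) (d : R) (x : bar_gen V) :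
  bar_gen (pf_shift V d) := (bshift d x.1, fun t => x.2 (t + d)).

(* Being a barcode basis does not depend on the order of the sequence, so the
   image of B may be taken as an initial segment. *)
Definition extends_to_basis V q (S : qsplitting V q)
  (B : seq (bar_gen (sp_ge S))) : Prop :=
  exists C : seq (bar_gen V), barcode_basis (map (gen_push (sp_in S)) B ++ C).

(** ** Ladder persistence modules *)

Record ladder := Ladder {
  ld_dom : pfunctor R F;
  ld_cod : pfunctor R F;
  ld_map : pf_hom ld_dom ld_cod
}.

Record ladder_iso (L M : ladder) := LadderIso {
  li_dom : pf_iso (ld_dom L) (ld_dom M);
  li_cod : pf_iso (ld_cod L) (ld_cod M);
  li_comm : forall t x,
    iso_fwd li_cod t (ld_map L t x) = ld_map M t (iso_fwd li_dom t x)
}.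

Definition ladder_dsum (L M : ladder) : ladder :=
  Ladder (dsum_hom (ld_map L) (ld_map M)).

(* [LadR JK] is R_J^K = (k_K, k_J, rho). *)
Inductive ladder_summand :=
| LadR J K of bprec J K
| LadIplus J
| LadIminus K.

Definition ladder_of (l : ladder_summand) : ladder :=
  match l with
  | LadR J K JK => Ladder (kint_rho F JK)
  | LadIplus J => Ladder (hom0 (kint F J) (pf0 R F))
  | LadIminus K => Ladder (hom0 (pf0 R F) (kint F K))
  end.

Definition ladder_sum (s : seq ladder_summand) : ladder :=
  foldr (fun l L => ladder_dsum (ladder_of l) L)
    (Ladder (hom0 (pf0 R F) (pf0 R F))) s.

(* The unit vector of k_J at the indices of J, and 0 elsewhere. *)
Definition kint_gen J : bar_gen (kint F J) := (J, fun t => const_mx 1).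

Definition summand_dom_gens (l : ladder_summand) :
  seq (bar_gen (ld_dom (ladder_of l))) :=
  match l with
  | LadR J K _ => [:: kint_gen K]
  | LadIplus J => [:: kint_gen J]
  | LadIminus _ => [::]
  end.

Definition summand_cod_gens (l : ladder_summand) :
  seq (bar_gen (ld_cod (ladder_of l))) :=
  match l with
  | LadR J K _ => [:: kint_gen J]
  | LadIplus _ => [::]
  | LadIminus K => [:: kint_gen K]
  end.

Definition gens_dsum (V W : pfunctor R F)
  (B : seq (bar_gen V)) (C : seq (bar_gen W)) : seq (bar_gen (dsum V W)) :=
  [seq (x.1, fun t => (x.2 t, 0)) | x : bar_gen V <- B] ++
  [seq (y.1, fun t => (0, y.2 t)) | y : bar_gen W <- C].

Fixpoint dom_gens (s : seq ladder_summand) :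
    seq (bar_gen (ld_dom (ladder_sum s))) :=
  if s is l :: s' then gens_dsum (summand_dom_gens l) (dom_gens s') else [::].

Fixpoint cod_gens (s : seq ladder_summand) :
    seq (bar_gen (ld_cod (ladder_sum s))) :=
  if s is l :: s' then gens_dsum (summand_cod_gens l) (cod_gens s') else [::].

Record ladder_decomposition (V W : pfunctor R F) (f : pf_hom V W) := LadderDec {
  dec_summands : seq ladder_summand;
  dec_iso : ladder_iso (Ladder f) (ladder_sum dec_summands)
}.

(* The generators of the domain and codomain that the isomorphism matches with
   the standard generators of the interval summands. *)
Definition obtained_in (V W : pfunctor R F) (f : pf_hom V W)
  (D : ladder_decomposition f)
  (B : seq (bar_gen V)) (C : seq (bar_gen W)) : Prop :=
  B = map (gen_push (iso_bwd (li_dom (dec_iso D)))) (dom_gens (dec_summands D)) /\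
  C = map (gen_push (iso_bwd (li_cod (dec_iso D)))) (cod_gens (dec_summands D)).

End Persistence.

(* Main.v *)
Require Import Defs.
From HB Require Import structures.
From mathcomp Require Import all_boot all_order all_algebra.
From mathcomp Require Import boolp reals constructive_ereal.
From mathcomp Require Import lra.
Set Implicit Arguments.
Unset Strict Implicit.
Unset Printing Implicit Defensive.
Import Order.TTheory GRing.Theory Num.Theory.
Local Open Scope ring_scope.

(** Put e = delta + q/2.  The map [q] vanishes on the bars shorter than q, so
    cutting these bars off does not change the composites of Phi and Psi once
    both have been shifted by q/2: each of the three morphisms is part of an
    e-interleaving pair between modules of nestedness larger than 2e.

    For such a pair let M be the matrix of the morphism in barcode bases of the
    domain and the codomain; its nonzero entries sit at pairs K \preceq J.  The
    interleaving gives, for every bar of length at least 2e, a nonzero entry at a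
    bar whose ends are within 2e of its own.  As strictly nested bars differ by
    more than 2e at both ends, every nonzero column has a greatest bar and every
    nonzero row a least one for \preceq.  Hence Gaussian elimination, taking the
    least column not yet reduced and pivoting on its greatest bar, uses only
    changes of basis that are allowed for barcode bases, and it ends with at most
    one nonzero entry in each row and column.

    Barcode bases of the long parts extend because the union with a barcode basis
    of the short part has the right bars, by uniqueness of barcodes. *)

(** * Barcode bases as families *)

Section FamilyBases.
Variables (R : realType) (F : fieldType).
Implicit Types (V W U Z : pfunctor R F) (I L : finType).

Definition is_gen V (x : bar_gen V) : Prop :=
  (forall t, ~~ in_bar x.1 t -> x.2 t = 0) /\
  (forall s t (st : s <= t), in_bar x.1 s -> pf_map V st (x.2 s) = x.2 t).

(** Sums run over all indices because generators vanish outside their bars; hence independence only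
    concerns the coefficients of bars containing [t]. Agreement of the bars with [Bar V] is
    recovered from uniqueness of barcodes. *)
Definition is_basis V I (x : I -> bar_gen V) : Prop :=
  (forall i, is_gen (x i)) /\
  forall t,
    (forall c : I -> F, \sum_i c i *: (x i).2 t = 0 ->
       forall i, in_bar (x i).1 t -> c i = 0) /\
    (forall v : V t, exists c : I -> F, v = \sum_i c i *: (x i).2 t).

Definition list_basis V (B : seq (bar_gen V)) : Prop :=
  is_basis (fun i => tnth (in_tuple B) i).

Lemma blo_le_bhi (J : bar R) : blo J <= bhi J.
Proof. exact: (valP J). Qed.

Lemma in_bar_lo (J : bar R) : in_bar J (blo J).
Proof. by rewrite /in_bar lexx blo_le_bhi. Qed.

Lemma in_bar_hi (J : bar R) : in_bar J (bhi J).
Proof. by rewrite /in_bar lexx blo_le_bhi. Qed.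

Lemma bar_ext (J K : bar R) : blo J = blo K -> bhi J = bhi K -> J = K.
Proof. by case: J K => [[a b] h] [[c d] k] /= ? ?; apply: val_inj; congr pair. Qed.

Lemma in_bar_shift (d : R) (J : bar R) t : in_bar (bshift d J) t = in_bar J (t + d).
Proof. by rewrite /in_bar /blo /bhi /= lerBlDr lerBrDr. Qed.

(** Past the upper end of the bar both sides vanish, so only the lower end constrains [s]. *)
Lemma is_gen_pf_map V (x : bar_gen V) (gx : is_gen x) s t (st : s <= t) :
  blo x.1 <= s -> pf_map V st (x.2 s) = x.2 t.
Proof.
move=> ls; have [xs|xs] := boolP (in_bar x.1 s); first exact: gx.2.
rewrite gx.1 // linear0 gx.1 //; apply: contra xs => /andP[_ tx].
by rewrite /in_bar ls (le_trans st tx).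
Qed.

Lemma is_basis_vanish V I (x : I -> bar_gen V) (bx : is_basis x) i t :
  ~~ in_bar (x i).1 t -> (x i).2 t = 0.
Proof. exact: (bx.1 i).1. Qed.

Lemma is_basis_pf_map V I (x : I -> bar_gen V) (bx : is_basis x) s t (st : s <= t)
    (c : I -> F) : (forall i, c i != 0 -> blo (x i).1 <= s) ->
  pf_map V st (\sum_i c i *: (x i).2 s) = \sum_i c i *: (x i).2 t.
Proof.
move=> cs; rewrite linear_sum; apply: eq_bigr => i _; rewrite linearZ /=.
have [->|/cs ls] := eqVneq (c i) 0; first by rewrite !scale0r.
by rewrite (is_gen_pf_map (bx.1 i)).
Qed.

Lemma is_basis_inj V I (x : I -> bar_gen V) (bx : is_basis x) t (c e : I -> F) :
  \sum_i c i *: (x i).2 t = \sum_i e i *: (x i).2 t ->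
  forall i, in_bar (x i).1 t -> c i = e i.
Proof.
move=> ce i xi; apply/eqP; rewrite -subr_eq0; apply/eqP.
apply: ((bx.2 t).1 (fun i => c i - e i)) xi.
by under eq_bigr do rewrite scalerBl; rewrite sumrB ce subrr.
Qed.

Lemma barcode_basisE (V : persmod R F) (B : seq (bar_gen V)) :
  barcode_basis B <-> perm_eq (unzip1 B) (Bar V) /\ list_basis B.
Proof.
have E (x : 'I_(size B) -> bar_gen V) t (c : 'I_(size B) -> F) :
    (forall k t, ~~ in_bar (x k).1 t -> (x k).2 t = 0) ->
    \sum_(k | in_bar (x k).1 t) c k *: (x k).2 t = \sum_k c k *: (x k).2 t.
  move=> x0; rewrite big_mkcond; apply: eq_bigr => k _.
  by case: ifPn => // /x0 ->; rewrite scaler0.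
split=> [[pB x0 xm xb]|[pB [xg xb]]].
  split=> //; split=> [k|t]; first by split; [exact: x0 | exact: xm].
  have [ind spn] := xb t; split=> [c|v]; first by rewrite -E //; exact: ind.
  by have [c ->] := spn v; exists c; rewrite E.
split=> // [k|k|t]; [exact: (xg k).1 | exact: (xg k).2 |].
have x0 k := (xg k).1.
have [ind spn] := xb t; split=> [c|v]; first by rewrite E //; exact: ind.
by have [c ->] := spn v; exists c; rewrite E.
Qed.

Lemma is_basis_reindex V I L (x : I -> bar_gen V) (h : L -> I) :
  bijective h -> is_basis x -> is_basis (x \o h).
Proof.
move=> bh [xg xb]; split=> [l|t]; first exact: xg.
have [g hK gK] := bh; have [ind spn] := xb t; split=> [c c0 l|v].
  rewrite -[l]hK; move: (h l) => i; rewrite /= gK => xi.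
  apply: (ind (c \o g)) => //; rewrite (reindex h) /=; last exact: onW_bij.
  by rewrite -[RHS]c0; apply: eq_bigr => k _; rewrite hK.
have [c ->] := spn v; exists (c \o h).
by rewrite (reindex h) //; exact: onW_bij.
Qed.

Lemma eq_is_basis V I (x y : I -> bar_gen V) : x =1 y -> is_basis x -> is_basis y.
Proof. by move=> /funext ->. Qed.

(** Families suit sums and changes of basis, while barcode bases and ladder decompositions are
    stated with sequences; the order of the sequence is left free. *)
Definition lists V I (x : I -> bar_gen V) (B : seq (bar_gen V)) : Prop :=
  exists2 s : seq I, perm_eq s (enum I) & B = map x s.

Lemma lists_tnth V (B : seq (bar_gen V)) : lists (fun i => tnth (in_tuple B) i) B.
Proof.
by exists (enum 'I_(size B)); rewrite // -[LHS]/(tval (in_tuple B)) map_tnth_enum.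
Qed.

(** The bound [n] is separate from [size s] since it arises as the size of another list, only
    provably equal to it. *)
Lemma tnth_perm_enum_bij I (s : seq I) n (e : n = size s) : perm_eq s (enum I) ->
  bijective (fun i : 'I_n => tnth (in_tuple s) (cast_ord e i)).
Proof.
move=> ps; have us : uniq s by rewrite (perm_uniq ps) enum_uniq.
apply: inj_card_bij => [i j|]; last by rewrite card_ord e (perm_size ps) -cardE.
have s0 := tnth (in_tuple s) (cast_ord e i).
rewrite !(tnth_nth s0) /= => /eqP.
by rewrite nth_uniq -?e // => /eqP/val_inj.
Qed.

Lemma lists_bij V I (x : I -> bar_gen V) (B : seq (bar_gen V)) : lists x B ->
  exists2 h : 'I_(size B) -> I,
    bijective h & forall i, tnth (in_tuple B) i = x (h i).
Proof.
case=> s ps ->.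
exists (fun i => tnth (in_tuple s) (cast_ord (size_map x s) i)).
  exact: tnth_perm_enum_bij.
move=> i; have s0 : I by case: s i {ps} => [[]|//].
rewrite (tnth_nth (x s0)) (tnth_nth s0) /= (nth_map s0) //.
by rewrite -(size_map x s).
Qed.

Lemma list_basis_lists V I (x : I -> bar_gen V) B :
  lists x B -> is_basis x -> list_basis B.
Proof.
move=> /lists_bij[h bh hE] /(is_basis_reindex bh); apply: eq_is_basis => i.
by rewrite hE.
Qed.

Definition sum_fam V I L (x : I -> bar_gen V) (y : L -> bar_gen V)
  (k : I + L) : bar_gen V :=
  match k with inl i => x i | inr l => y l end.

Lemma lists_cat V I L (x : I -> bar_gen V) (y : L -> bar_gen V) B C :
  lists x B -> lists y C -> lists (sum_fam x y) (B ++ C).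
Proof.
move=> [s ps ->] [r pr ->]; exists (map inl s ++ map inr r); last first.
  by rewrite map_cat -!map_comp.
apply: uniq_perm; rewrite ?enum_uniq //.
  rewrite cat_uniq !map_inj_uniq; try by move=> ? ? [].
  rewrite (perm_uniq ps) (perm_uniq pr) !enum_uniq /= andbT.
  by apply/hasPn => k /mapP[l _ ->]; apply/mapP => -[].
move=> k; rewrite mem_enum mem_cat; case: k => k.
  by rewrite map_f ?(perm_mem ps) ?mem_enum.
by rewrite orbC map_f ?(perm_mem pr) ?mem_enum.
Qed.

Lemma lists_map V W I (x : I -> bar_gen V) (g : bar_gen V -> bar_gen W) B :
  lists x B -> lists (g \o x) (map g B).
Proof. by move=> [s ps ->]; exists s; rewrite // -map_comp. Qed.

(** * Bases of direct sums, isomorphic modules and interval modules *)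

Definition gen_inl V W (x : bar_gen V) : bar_gen (dsum V W) :=
  (x.1, fun t => (x.2 t, 0)).
Definition gen_inr V W (y : bar_gen W) : bar_gen (dsum V W) :=
  (y.1, fun t => (0, y.2 t)).

Lemma is_basis_dsum V W I L (x : I -> bar_gen V) (y : L -> bar_gen W) :
  is_basis x -> is_basis y ->
  is_basis (sum_fam (@gen_inl V W \o x) (@gen_inr V W \o y)).
Proof.
move=> bx bY; have E t (c : I + L -> F) :
    \sum_k c k *: (sum_fam (@gen_inl V W \o x) (@gen_inr V W \o y) k).2 t =
    (\sum_i c (inl i) *: (x i).2 t, \sum_l c (inr l) *: (y l).2 t).
  rewrite big_sumType /=; apply: injective_projections.
    rewrite /= !(linear_sum fst) /= [X in _ + X]big1 ?addr0 // => l _.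
    exact: scaler0.
  rewrite /= !(linear_sum snd) /= [X in X + _]big1 ?add0r // => l _.
  exact: scaler0.
split.
  case=> k; split=> [t xt|s t st xs] /=.
  - by rewrite (bx.1 k).1.
  - by rewrite /dsum_map /= linear0 (bx.1 k).2.
  - by rewrite (bY.1 k).1.
  - by rewrite /dsum_map /= linear0 (bY.1 k).2.
move=> t; split=> [c|[v w]].
  rewrite E => -[c1 c2] [i|l] /=; first exact: (bx.2 t).1 (fun i => c (inl i)) _ _.
  exact: (bY.2 t).1 (fun i => c (inr i)) _ _.
have [c ->] := (bx.2 t).2 v; have [e ->] := (bY.2 t).2 w.
by exists (fun k => match k with inl i => c i | inr l => e l end); rewrite E.
Qed.

Lemma list_basis_dsum V W (B : seq (bar_gen V)) (C : seq (bar_gen W)) :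
  list_basis B -> list_basis C -> list_basis (gens_dsum B C).
Proof.
move=> bB bC; apply: list_basis_lists (is_basis_dsum bB bC).
by apply: lists_cat; apply: lists_map; exact: lists_tnth.
Qed.

Lemma is_basis_iso V W (f : pf_iso V W) I (x : I -> bar_gen V) :
  is_basis x -> is_basis (gen_push (iso_fwd f) \o x).
Proof.
move=> bx; have E t (c : I -> F) :
    \sum_k c k *: (gen_push (iso_fwd f) (x k)).2 t =
    iso_fwd f t (\sum_k c k *: (x k).2 t).
  by rewrite linear_sum; apply: eq_bigr => i _; rewrite linearZ.
split=> [i|t].
  split=> [t xt|s t st xs] /=; first by rewrite (bx.1 i).1 ?linear0.
  by rewrite -hom_nat (bx.1 i).2.
split=> [c|w].
  rewrite E => /(congr1 (iso_bwd f t)); rewrite iso_fwdK linear0.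
  exact: (bx.2 t).1.
have [c e] := (bx.2 t).2 (iso_bwd f t w); exists c.
by rewrite E -e iso_bwdK.
Qed.

Definition iso_sym V W (f : pf_iso V W) : pf_iso W V := Iso (iso_bwdK f) (iso_fwdK f).

Lemma list_basis_iso V W (f : pf_iso V W) (B : seq (bar_gen V)) :
  list_basis B -> list_basis (map (gen_push (iso_fwd f)) B).
Proof.
move=> bB; apply: list_basis_lists (is_basis_iso f bB).
by apply: lists_map; exact: lists_tnth.
Qed.

Lemma list_basis_kint (J : bar R) : list_basis [:: kint_gen F J].
Proof.
have h : lists (fun _ : unit => kint_gen F J) [:: kint_gen F J].
  by exists [:: tt]; rewrite ?enumT ?unlock.
apply: (list_basis_lists h); split=> [_|t].
  split=> [t /= Jt|s t st /= Js].
    (* The dimension is the boolean [in_bar J t]; at [false] there is a single row vector. *)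
    by move: (const_mx 1); rewrite (negbTE Jt) => v; rewrite thinmx0.
  rewrite Js; case: (in_bar J t); last by rewrite !thinmx0.
  by rewrite pid_mx_1 mulmx1.
have E (c : unit -> F) (f : unit -> kint F J t) : \sum_i c i *: f i = c tt *: f tt.
  by rewrite (bigD1 tt) //= big1 ?addr0 // => -[].
split=> [c|v].
  rewrite E /= => + [] Jt; rewrite Jt => /matrixP/(_ ord0 ord0).
  by rewrite !mxE mulr1.
have [Jt|Jt] := boolP (in_bar J t); last first.
  exists (fun _ => 0); move: (\sum_i _) v; rewrite /= (negbTE Jt) => u v.
  by rewrite !thinmx0.
suff [a ->] : exists a, v = a *: const_mx 1 by exists (fun=> a); rewrite E.
move: v; rewrite /= Jt => v; exists (v 0 0).
by apply/matrixP => i j; rewrite !ord1 !mxE mulr1.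
Qed.

Lemma list_basis_pf0 : list_basis ([::] : seq (bar_gen (pf0 R F))).
Proof.
split=> [[]//|t]; split=> [c _ []//|v].
by exists (fun _ => 0); rewrite big_ord0 [v]thinmx0.
Qed.

Lemma interval_sum_basis (s : seq (bar R)) :
  exists2 B : seq (bar_gen (interval_sum F s)), unzip1 B = s & list_basis B.
Proof.
elim: s => [|J s [B Bs bB]]; first by exists [::]; rewrite //; exact: list_basis_pf0.
exists (gens_dsum [:: kint_gen F J] B).
  by rewrite /unzip1 /gens_dsum /= -map_comp -[RHS](congr1 (cons J) Bs).
by apply: list_basis_dsum; first exact: list_basis_kint.
Qed.

Lemma exists_list_basis (V : persmod R F) :
  exists2 B : seq (bar_gen V), unzip1 B = Bar V & list_basis B.
Proof.
have [f] := BarP V; have [B BV bB] := interval_sum_basis (Bar V).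
exists (map (gen_push (iso_fwd (iso_sym f))) B); last exact: list_basis_iso.
by rewrite -[RHS]BV /unzip1 -map_comp.
Qed.

(** * Bases of shifted modules *)

Lemma is_basis_shift V (d : R) I (x : I -> bar_gen V) :
  is_basis x -> is_basis (@gen_shift R F V d \o x).
Proof.
move=> bx; split=> [i|t].
  split=> [t|s t st] /=; rewrite in_bar_shift; first exact: (bx.1 i).1.
  exact: (bx.1 i).2.
have [ind spn] := bx.2 (t + d); split=> [c /ind c0 i|//].
by rewrite /= in_bar_shift; exact: c0.
Qed.

Lemma unshift_le (d t : R) : t - d + d <= t.
Proof. by rewrite subrK. Qed.

(** The indices [t - d + d] and [t] are equal but not convertible, so the inner morphism between
    them identifies the two spaces. *)
Definition gen_unshift V (d : R) (y : bar_gen (pf_shift V d)) : bar_gen V :=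
  (bshift (- d) y.1, fun t => pf_map V (unshift_le d t) (y.2 (t - d))).

Lemma gen_unshiftK V (d : R) : cancel (@gen_unshift V d) (@gen_shift R F V d).
Proof.
move=> [J y]; congr pair => /=.
  by apply: bar_ext; rewrite /blo /bhi /= /blo /bhi /= opprK addrK.
apply: functional_extensionality_dep => t.
(* Abstracting [t + d - d] lets its equality with [t] be substituted; the inner morphism is then an
   identity. *)
have e := addrK d t; move: (unshift_le _ _); rewrite -/(pf_sp _ _).
move: (t + d - d) e => s -> h; exact: pf_id.
Qed.

Lemma is_basis_unshift V (d : R) I (y : I -> bar_gen (pf_shift V d)) :
  is_basis y -> is_basis (@gen_unshift V d \o y).
Proof.
move=> bY; split=> [i|t].
  split=> [t|s t st] /=; rewrite in_bar_shift => ys.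
    by rewrite (bY.1 i).1 ?linear0.
  have st' : s - d <= t - d by rewrite lerD2r.
  rewrite -(@is_gen_pf_map _ _ (bY.1 i) _ _ st') /=; last by case/andP: ys.
  exact: pf_square.
have := bY.2 (t - d) => /=; have := subrK d t; move: (unshift_le d t).
rewrite /is_basis.
(* For a free [s] in place of [t - d], the index [t] can be replaced by [s + d]. *)
suff H s (h : s + d <= t) : s + d = t ->
  (forall c, \sum_i c i *: (y i).2 s = 0 -> forall i, in_bar (y i).1 s -> c i = 0) /\
  (forall v : V (s + d), exists c, v = \sum_i c i *: (y i).2 s) ->
  (forall c, \sum_i c i *: pf_map V h ((y i).2 s) = 0 ->
     forall i, in_bar (bshift (- d) (y i).1) t -> c i = 0) /\
  (forall v : V t, exists c, v = \sum_i c i *: pf_map V h ((y i).2 s)).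
  by move=> h e; exact: H.
move=> e; move: h; rewrite -e => h [ind spn].
split=> [c|v].
  under eq_bigr do rewrite pf_id.
  by move=> /ind c0 i; rewrite in_bar_shift addrK; exact: c0.
by have [c ->] := spn v; exists c; apply: eq_bigr => i _; rewrite pf_id.
Qed.

End FamilyBases.

(** * Matrices of morphisms *)

Section Matrices.
Variables (R : realType) (F : fieldType).
Implicit Types (V W U Z : pfunctor R F) (I L : finType).

(* Comparing the image of [x i] with the column [i] at the first index of the
   bar of [x i] is enough, by compatibility with the inner morphisms. *)
Definition has_matrix V U (f : pf_hom V U) I L
    (x : I -> bar_gen V) (y : L -> bar_gen U) (M : L -> I -> F) : Prop :=
  (forall l i, M l i != 0 -> bprec (y l).1 (x i).1) /\
  (forall i, let t := blo (x i).1 in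
     f t ((x i).2 t) = \sum_l M l i *: (y l).2 t).

(** Naturality carries the formula from the lower end to [t]; every [y l] that occurs starts no
    later than [x i], so the sum can be pushed along. *)
Lemma has_matrixE V U (f : pf_hom V U) I L (x : I -> bar_gen V)
    (y : L -> bar_gen U) M : is_basis x -> is_basis y -> has_matrix f x y M ->
  forall i t, in_bar (x i).1 t -> f t ((x i).2 t) = \sum_l M l i *: (y l).2 t.
Proof.
move=> bx bY [Mp ME] i t /andP[xt _].
rewrite -(is_gen_pf_map (bx.1 i) xt (lexx _)) hom_nat ME.
by apply: is_basis_pf_map => // l /Mp/and3P[].
Qed.

(* A generator surviving strictly beyond the end of [x i] cannot occur in the
   image of [x i], as that image vanishes there. *)
Lemma has_matrix_mask V U (f : pf_hom V U) I L (x : I -> bar_gen V)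
    (y : L -> bar_gen U) (c : L -> I -> F) :
  is_basis x -> is_basis y ->
  (forall i, let t := blo (x i).1 in
     f t ((x i).2 t) = \sum_l c l i *: (y l).2 t) ->
  has_matrix f x y (fun l i => if in_bar (y l).1 (blo (x i).1) then c l i else 0).
Proof.
move=> bx bY cE; set M := fun l i => _.
have ME i : let t := blo (x i).1 in f t ((x i).2 t) = \sum_l M l i *: (y l).2 t.
  rewrite /= cE; apply: eq_bigr => l _; rewrite /M; case: ifPn => // yx.
  by rewrite (is_basis_vanish bY) // !scaler0.
have M0 l i : M l i != 0 -> in_bar (y l).1 (blo (x i).1).
  by rewrite /M; case: ifP => // _; rewrite eqxx.
split=> // l i Ml; have /andP[yx xy] := M0 _ _ Ml; apply/and3P; split=> //.
rewrite leNgt; apply: contra Ml => xly; apply/eqP.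
apply: ((bY.2 (bhi (y l).1)).1 (fun l => M l i)); last exact: in_bar_hi.
rewrite -(is_basis_pf_map bY xy) => [|k /M0/andP[]//].
rewrite -(ME i) -hom_nat (is_gen_pf_map (bx.1 i)) // (is_basis_vanish bx) ?linear0 //.
by apply/negP => /andP[_]; rewrite leNgt xly.
Qed.

Lemma exists_matrix V U (f : pf_hom V U) I L (x : I -> bar_gen V)
    (y : L -> bar_gen U) : is_basis x -> is_basis y -> exists M, has_matrix f x y M.
Proof.
move=> bx bY.
have /choice[c cE] : forall i, exists c : L -> F,
    f (blo (x i).1) ((x i).2 (blo (x i).1)) = \sum_l c l *: (y l).2 (blo (x i).1).
  by move=> i; exact: (bY.2 _).2.
by have := has_matrix_mask bx bY (c := fun l i => c i l) cE; eexists; eassumption.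
Qed.

Lemma has_matrix_shift V U (f : pf_hom V U) (d : R) I L (x : I -> bar_gen V)
    (y : L -> bar_gen U) M : is_basis x -> is_basis y -> has_matrix f x y M ->
  has_matrix (shift_hom f d) (@gen_shift R F V d \o x) (@gen_shift R F U d \o y) M.
Proof.
move=> bx bY hM; split=> [l i /hM.1|i].
  by rewrite /bprec /blo /bhi /= !lerD2r.
have -> : blo ((@gen_shift R F V d \o x) i).1 = blo (x i).1 - d by [].
by apply: (has_matrixE bx bY hM); rewrite subrK in_bar_lo.
Qed.

(** Compares the coefficients of [z j] in two expansions of the image of [x i] at [t]; the [y l]
    whose bars miss [t] vanish and drop out. *)
Lemma matrix_comp V U Z (f : pf_hom V U) (g : pf_hom U Z) I L
    (x : I -> bar_gen V) (y : L -> bar_gen U) (z : I -> bar_gen Z) M N :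
  is_basis x -> is_basis y -> is_basis z ->
  has_matrix f x y M -> has_matrix g y z N ->
  forall t i j, g t (f t ((x i).2 t)) = (z i).2 t ->
    in_bar (x i).1 t -> in_bar (z j).1 t ->
  \sum_(l | in_bar (y l).1 t) N j l * M l i = (j == i)%:R.
Proof.
move=> bx bY bz hM hN t i j gf xt zt.
pose c j := \sum_(l | in_bar (y l).1 t) N j l * M l i.
suff: \sum_j c j *: (z j).2 t = \sum_j (j == i)%:R *: (z j).2 t.
  by move=> /(is_basis_inj bz)/(_ j zt).
rewrite [RHS](bigD1 i) //= eqxx scale1r [X in _ = _ + X]big1 ?addr0; last first.
  by move=> k /negbTE ->; rewrite scale0r.
rewrite -gf (has_matrixE bx bY hM) // linear_sum.
rewrite [RHS](bigID (fun l => in_bar (y l).1 t)) /= [X in _ = _ + X]big1; last first.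
  by move=> l yt; rewrite linearZ (is_basis_vanish bY) //= linear0 scaler0.
rewrite addr0; under [RHS]eq_bigr => l yt.
  rewrite linearZ /= (has_matrixE bY bz hN) // scaler_sumr.
  under eq_bigr do rewrite scalerA mulrC.
  over.
by rewrite exchange_big; apply: eq_bigr => k _; rewrite scaler_suml.
Qed.

(** A diagonal coefficient equal to 1 needs a nonzero term. The index [l] found is squeezed between
    the bars of [z i] and [x i]. *)
Lemma matrix_comp_match V U Z (f : pf_hom V U) (g : pf_hom U Z) I L
    (x : I -> bar_gen V) (y : L -> bar_gen U) (z : I -> bar_gen Z) M N :
  is_basis x -> is_basis y -> is_basis z ->
  has_matrix f x y M -> has_matrix g y z N ->
  forall t i, g t (f t ((x i).2 t)) = (z i).2 t ->
    in_bar (x i).1 t -> in_bar (z i).1 t -> exists2 l, M l i != 0 & N i l != 0.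
Proof.
move=> bx bY bz hM hN t i gf xt zt.
have := matrix_comp bx bY bz hM hN gf xt zt; rewrite eqxx => sum1.
have [l|all0] := pickP (fun l => (M l i != 0) && (N i l != 0)).
  by case/andP; exists l.
have /eqP := sum1; rewrite big1 1?eq_sym ?oner_eq0 // => l _; apply/eqP.
by have := all0 l; rewrite mulf_eq0 orbC => /negbT; rewrite negb_and !negbK.
Qed.

(** * Uniqueness of barcodes *)

Definition hom_id V : pf_hom V V :=
  @Defs.Hom R F V V (fun t => (idfun : {linear V t -> V t})) (fun s t st x => erefl).

Lemma bprec_anti (J K : bar R) : bprec J K -> bprec K J -> J = K.
Proof.
move=> /and3P[a _ b] /and3P[c _ d].
by apply: bar_ext; apply: le_anti; rewrite ?a ?b.
Qed.

(* The matrices of the identity in both directions, restricted to the generators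
   with bar [J], are inverse to each other: a bar [K] contributing to the product
   satisfies [bprec J K] and [bprec K J]. *)
Lemma leq_card_bar V I L (x : I -> bar_gen V) (y : L -> bar_gen V) J :
  is_basis x -> is_basis y ->
  (#|[pred i | (x i).1 == J]| <= #|[pred l | (y l).1 == J]|)%N.
Proof.
move=> bx bY; have [M hM] := exists_matrix (hom_id V) bx bY.
have [N hN] := exists_matrix (hom_id V) bY bx.
set A := [pred i | _]; set B := [pred l | _].
pose MN : 'M[F]_(#|A|, #|B|) := \matrix_(i, l) N (enum_val i) (enum_val l).
pose MM : 'M[F]_(#|B|, #|A|) := \matrix_(l, i) M (enum_val l) (enum_val i).
(* An identity matrix of size [#|A|] that factors through dimension [#|B|] forces [#|A| <= #|B|]. *)
apply: (@mulmx1_min F _ _ MN MM).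
apply/matrixP => i j; rewrite !mxE.
have /eqP iJ := enum_valP i; have /eqP jJ := enum_valP j.
under eq_bigr do rewrite !mxE.
rewrite -(big_enum_val (fun l => N (enum_val i) l * M l (enum_val j))) /=.
rewrite -(inj_eq enum_val_inj) -(@matrix_comp V V V (hom_id V) (hom_id V) I L
  x y x M N bx bY bx hM hN (blo J)) //; last 2 first.
- by rewrite jJ in_bar_lo.
- by rewrite iJ in_bar_lo.
rewrite [LHS]big_mkcond [RHS]big_mkcond; apply: eq_bigr => l _.
rewrite !inE; case: eqVneq => [->|yJ]; first by rewrite in_bar_lo.
case: ifP => // _; apply/esym/eqP; rewrite mulf_eq0.
apply: contraNT yJ; rewrite negb_or => /andP[/hN.1 + /hM.1].
by rewrite iJ jJ => p1 p2; apply/eqP/bprec_anti.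
Qed.

Lemma count_bar V (B : seq (bar_gen V)) J :
  count_mem J (unzip1 B) = #|[pred i | (tnth (in_tuple B) i).1 == J]|.
Proof.
rewrite -sum1_count big_map big_tnth -sum1_card.
by apply: eq_bigl => i.
Qed.

Lemma barcode_unique V (B C : seq (bar_gen V)) :
  list_basis B -> list_basis C -> perm_eq (unzip1 B) (unzip1 C).
Proof.
move=> bB bC; apply/allP => J _ /=; rewrite !count_bar eqn_leq.
by rewrite !leq_card_bar.
Qed.

Lemma barcode_basis_extends (V : persmod R F) q (S : qsplitting V q)
    (B : seq (bar_gen (sp_ge S))) :
  barcode_basis B -> extends_to_basis B.
Proof.
move=> /barcode_basisE[_ bB]; have [C _ bC] := exists_list_basis (sp_lt S).
have := list_basis_iso (iso_sym (sp_iso S)) (list_basis_dsum bB bC).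
rewrite map_cat -!map_comp => b.
eexists; apply/barcode_basisE; split; last exact: b.
have [B' <- bB'] := exists_list_basis V.
exact: barcode_unique.
Qed.

End Matrices.

(** * Elimination *)

Section Elimination.
Variables (R : realType) (F : fieldType).
Implicit Types (V W U Z : pfunctor R F) (I L : finType).

Lemma bprec_refl (J : bar R) : bprec J J.
Proof. by rewrite /bprec !lexx blo_le_bhi. Qed.

(** Row [i] of [u] holds the coefficients of the new generator. The explicit cut-off is for indices
    before the bar, where an [x j] starting earlier may be nonzero. *)
Definition change_gen V I (x : I -> bar_gen V) (S : pred I) (u : I -> I -> F)
    (i : I) : bar_gen V :=
  if S i then ((x i).1, fun t => if in_bar (x i).1 t
                                 then \sum_j u i j *: (x j).2 t else 0)
  else x i.

Lemma change_gen_bar V I (x : I -> bar_gen V) S u i :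
  (change_gen x S u i).1 = (x i).1.
Proof. by rewrite /change_gen; case: ifP. Qed.

Lemma change_gen_out V I (x : I -> bar_gen V) (S : pred I) u i :
  ~~ S i -> change_gen x S u i = x i.
Proof. by rewrite /change_gen => /negbTE ->. Qed.

Lemma change_genE V I (x : I -> bar_gen V) (S : pred I) (u : I -> I -> F) :
  is_basis x -> (forall i j, S i -> u i j != 0 -> bprec (x j).1 (x i).1) ->
  forall i t, S i -> blo (x i).1 <= t ->
  (change_gen x S u i).2 t = \sum_j u i j *: (x j).2 t.
Proof.
move=> bx up i t Si xt; rewrite /change_gen Si /=; case: ifPn => // txi.
rewrite big1 // => j _; have [->|uj] := eqVneq (u i j) 0; first by rewrite scale0r.
rewrite (is_basis_vanish bx) ?scaler0 //; apply: contra txi => /andP[_ tj].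
by rewrite /in_bar xt (le_trans tj) //; case/and3P: (up _ _ Si uj).
Qed.

(** On [S] the matrix [u] is diagonal and invertible, and the generators outside [S] are kept, so
    the change of basis is block triangular. *)
Lemma is_basis_change V I (x : I -> bar_gen V) (S : pred I) (u : I -> I -> F) :
  is_basis x -> (forall i j, S i -> u i j != 0 -> bprec (x j).1 (x i).1) ->
  (forall i, S i -> u i i != 0) ->
  (forall i j, S i -> S j -> j != i -> u i j = 0) ->
  is_basis (change_gen x S u).
Proof.
move=> bx up u1 u0; split=> [i|t].
  case Si: (S i); last by rewrite /change_gen Si; exact: bx.1.
  split=> [t|s t st]; rewrite change_gen_bar => xt.
    by rewrite /change_gen Si /= (negbTE xt).
  have xs : blo (x i).1 <= s by case/andP: xt.
  rewrite !change_genE ?(le_trans xs st) //; apply: is_basis_pf_map => // j uj.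
  by rewrite (le_trans _ xs) //; case/and3P: (up _ _ Si uj).
(* Old coordinates of a combination [c] of the new generators, put to 0 at those [j] in [S] whose
   generator vanishes at [t]. *)
pose e (c : I -> F) j := if S j then if in_bar (x j).1 t then c j * u j j else 0
  else c j + \sum_(i | S i && in_bar (x i).1 t) c i * u i j.
have E (c : I -> F) : \sum_i c i *: (change_gen x S u i).2 t = \sum_j e c j *: (x j).2 t.
  rewrite (bigID (fun i => S i && in_bar (x i).1 t)) /=.
  have -> : \sum_(i | ~~ (S i && in_bar (x i).1 t)) c i *: (change_gen x S u i).2 t =
            \sum_i (if S i then 0 else c i) *: (x i).2 t.
    rewrite big_mkcond; apply: eq_bigr => i _; rewrite /change_gen.
    by case: (S i) => //=; case: in_bar => //=; rewrite ?scaler0 scale0r.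
  under eq_bigr => i /andP[Si xi].
    rewrite change_genE //; last by case/andP: xi.
    rewrite scaler_sumr; under eq_bigr do rewrite scalerA.
    over.
  rewrite exchange_big -big_split; apply: eq_bigr => j _ /=.
  rewrite -scaler_suml -scalerDl; congr (_ *: _); rewrite /e.
  case Sj: (S j); last by rewrite addrC.
  rewrite addr0; case xj: (in_bar _ _).
    rewrite (bigD1 j) ?Sj //= big1 ?addr0 // => i /andP[/andP[Si _] ij].
    by rewrite u0 ?mulr0 // eq_sym.
  rewrite big1 // => i /andP[Si xi]; rewrite u0 ?mulr0 //.
  by apply: contraFneq xj => ->.
split=> [c|v].
  rewrite E => /(bx.2 t).1 e0.
  have c0 i : S i && in_bar (x i).1 t -> c i = 0.
    move=> /andP[Si xi]; have := e0 i xi; rewrite /e Si xi => /eqP.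
    by rewrite mulf_eq0 (negbTE (u1 _ Si)) orbF => /eqP.
  move=> i; rewrite change_gen_bar => xi; have := e0 i xi.
  case Si: (S i); first by move=> _; rewrite c0 ?Si.
  by rewrite /e Si big1 ?addr0 // => j /c0 ->; rewrite mul0r.
have [a ->] := (bx.2 t).2 v.
(* Back substitution: divide by the diagonal on [S], then subtract what this contributes outside
   [S]. *)
pose b i := a i / u i i.
exists (fun i => if S i then b i
  else a i - \sum_(j | S j && in_bar (x j).1 t) b j * u j i).
rewrite E; apply: eq_bigr => j _; rewrite /e.
case Sj: (S j); last first.
  by under [X in _ - _ + X]eq_bigr => i /andP[-> _] do []; rewrite subrK.
case: ifPn => [_|xj]; first by rewrite /b divfK ?u1.
by rewrite (is_basis_vanish bx) // !scaler0.
Qed.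

(** A zero column is isolated, so if all columns are, the matrix is a partial permutation matrix. *)
Definition isolated I L (M : L -> I -> F) (i : I) : Prop :=
  forall l, M l i != 0 ->
    [/\ M l i = 1, forall l', l' != l -> M l' i = 0
      & forall i', i' != i -> M l i' = 0].

Definition extremal_entries V U I L (x : I -> bar_gen V) (y : L -> bar_gen U)
    (M : L -> I -> F) : Prop :=
  (forall i k, M k i != 0 -> exists2 l, M l i != 0 &
     forall l', M l' i != 0 -> bprec (y l').1 (y l).1) /\
  (forall l k, M l k != 0 -> exists2 i, M l i != 0 &
     forall i', M l i' != 0 -> bprec (x i).1 (x i').1).

(* Gaussian elimination at the entry [(l, i)]: the new [y l] is the image of
   [x i], and the other entries of the row [l] are cleared by subtracting
   multiples of [x i]; both are legal changes of basis as [y l] is the greatest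
   bar of the column [i] and [x i] the least bar of the row [l]. *)
Lemma isolate_entry V U (f : pf_hom V U) I L (x : I -> bar_gen V)
    (y : L -> bar_gen U) M (i : I) (l : L) :
  is_basis x -> is_basis y -> has_matrix f x y M -> M l i != 0 ->
  (forall l', M l' i != 0 -> bprec (y l').1 (y l).1) ->
  (forall i', M l i' != 0 -> bprec (x i).1 (x i').1) ->
  exists x' y' M', [/\ is_basis x' /\ is_basis y',
    forall j, (x' j).1 = (x j).1, forall k, (y' k).1 = (y k).1,
    has_matrix f x' y' M' &
    isolated M' i /\ forall j, j != i -> isolated M j -> isolated M' j].
Proof.
move=> bx bY hM Mli lmax imin.
pose c0 j := M l j / M l i.
(* Coefficients of [x j - c0 j *: x i], used for [j != i] only. *)
pose u j k : F := (k == j)%:R - (k == i)%:R * c0 j.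
pose x' := change_gen x (predC1 i) u.
pose y' := change_gen y (pred1 l) (fun _ k => M k i).
have yp k k' : pred1 l k -> M k' i != 0 -> bprec (y k').1 (y k).1.
  by move=> /= /eqP ->; exact: lmax.
have up j k : predC1 i j -> u j k != 0 -> bprec (x k).1 (x j).1.
  rewrite /u /=; have [-> _ _|_ _] := eqVneq k j; first exact: bprec_refl.
  have [-> |_] := eqVneq k i; last by rewrite mul0r subr0 eqxx.
  rewrite mul1r sub0r oppr_eq0 mulf_eq0 negb_or => /andP[Mj _].
  exact: imin.
have bx' : is_basis x'.
  apply: is_basis_change => // [j ji|j k ji ki kj]; rewrite /u.
    by rewrite eqxx (negbTE ji) mul0r subr0 oner_eq0.
  by rewrite (negbTE ki) (negbTE kj) mul0r subr0.
have by' : is_basis y'.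
  by apply: is_basis_change => // [k /eqP ->|k k' /eqP-> /eqP->]; rewrite ?eqxx.
(* The new matrix before masking. Replacing [y l] affects only column [i]: in the others the
   coefficient of the old [y l] has been cleared. *)
pose c k j : F := if j == i then (k == l)%:R
  else if k == l then 0 else M k j - c0 j * M k i.
have cE j : let t := blo (x' j).1 in
    f t ((x' j).2 t) = \sum_k c k j *: (y' k).2 t.
  rewrite change_gen_bar /=; set t := blo _.
  have [ji|ji] := eqVneq j i.
    rewrite /x' change_gen_out /= ?negbK ?ji // -ji (hM.2 j) -/t.
    rewrite [RHS](bigD1 l) //= /c ji !eqxx scale1r [X in _ = _ + X]big1; last first.
      by move=> k /negbTE ->; rewrite scale0r.
    rewrite addr0 change_genE //=.
    by rewrite /t ji; case/and3P: (hM.1 _ _ Mli).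
  rewrite /x' change_genE //.
  have -> : \sum_k u j k *: (x k).2 t = (x j).2 t - c0 j *: (x i).2 t.
    rewrite /u; under eq_bigr do rewrite scalerBl; rewrite sumrB; congr (_ - _).
      rewrite (bigD1 j) //= eqxx scale1r big1 ?addr0 // => k /negbTE ->.
      by rewrite scale0r.
    rewrite (bigD1 i) //= eqxx mul1r big1 ?addr0 // => k /negbTE ->.
    by rewrite mul0r scale0r.
  rewrite linearB linearZ /= (hM.2 j) -/t.
  (* Here [t] is the lower end of [x j]. If [c0 j] is nonzero, then minimality of [x i] in the row
     puts [t] in the bar of [x i]. *)
  have -> : c0 j *: f t ((x i).2 t) = \sum_k (c0 j * M k i) *: (y k).2 t.
    have [c00|cj] := eqVneq (c0 j) 0.
      by rewrite c00 scale0r big1 // => k _; rewrite mul0r scale0r.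
    rewrite (has_matrixE bx bY hM); last first.
      have /imin/and3P[] : M l j != 0.
        by apply: contraNneq cj => Mj; rewrite /c0 Mj mul0r.
      by rewrite /in_bar /t => -> ->.
    by rewrite scaler_sumr; apply: eq_bigr => k _; rewrite scalerA.
  rewrite -sumrB; apply: eq_bigr => k _; rewrite -scalerBl /c (negbTE ji).
  have [->|kl] := eqVneq k l; first by rewrite /c0 divfK // subrr !scale0r.
  by rewrite /y' change_gen_out.
exists x', y', (fun k j => if in_bar (y' k).1 (blo (x' j).1) then c k j else 0).
split=> //; try exact: change_gen_bar; first exact: has_matrix_mask.
have ci k : c k i = (k == l)%:R by rewrite /c eqxx.
have cl j : j != i -> c l j = 0 by rewrite /c eqxx => /negbTE ->.
split=> [k|j ji isoj k].
  case: ifP => _; last by rewrite eqxx.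
  rewrite ci; case: (eqVneq k l) => [->|_]; last by rewrite eqxx.
  split=> // [k' /negbTE kl|j /cl ->]; last by rewrite if_same.
  by rewrite ci kl if_same.
(* A nonzero entry there would be alone in row [l], against the pivot; hence elimination leaves
   column [j] unchanged. *)
have Mlj : M l j = 0.
  apply/eqP; apply: contraT => Mlj; have [_ _ Mi] := isoj _ Mlj.
  by move: Mli; rewrite Mi ?eqxx // eq_sym.
have cj k' : k' != l -> c k' j = M k' j.
  by move=> kl; rewrite /c (negbTE ji) (negbTE kl) /c0 Mlj !mul0r subr0.
have clj := cl j ji.
case: ifP => [_|]; last by rewrite eqxx.
have [->|kl] := eqVneq k l; first by rewrite clj eqxx.
rewrite cj // => /isoj[M1 Mk Mi]; split=> // [k' kk|j' jj].
  by have [->|k'l] := eqVneq k' l; rewrite ?clj ?cj ?Mk ?if_same.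
have -> : c k j' = 0; last by rewrite if_same.
have [->|j'i] := eqVneq j' i; first by rewrite /c eqxx (negbTE kl).
(* Row [k] is zero off column [j], in particular at [i], so nothing is subtracted from it. *)
rewrite /c (negbTE j'i) (negbTE kl) Mi // sub0r (_ : M k i = 0) ?mulr0 ?oppr0 //.
by apply: Mi; rewrite eq_sym.
Qed.

(** Extremality is assumed for all bases with the given bars, because each elimination step changes
    the bases and the matrix but keeps the bars. *)
Lemma reduce_matrix V U (f : pf_hom V U) I L (x : I -> bar_gen V)
    (y : L -> bar_gen U) :
  is_basis x -> is_basis y ->
  (forall x' y' M, is_basis x' -> is_basis y' ->
     (forall i, (x' i).1 = (x i).1) -> (forall l, (y' l).1 = (y l).1) ->
     has_matrix f x' y' M -> extremal_entries x' y' M) ->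
  exists x' y' M, [/\ is_basis x' /\ is_basis y',
    forall i, (x' i).1 = (x i).1, forall l, (y' l).1 = (y l).1,
    has_matrix f x' y' M & forall i, isolated M i].
Proof.
move=> bx bY ext; have [M hM] := exists_matrix f bx bY.
(* [P] collects columns already isolated, and [n] bounds the number of the others. *)
suff H n x' y' M' (P : {set I}) : (#|~: P| <= n)%N ->
    is_basis x' -> is_basis y' ->
    (forall i, (x' i).1 = (x i).1) -> (forall l, (y' l).1 = (y l).1) ->
    has_matrix f x' y' M' -> {in P, forall i, isolated M' i} ->
    exists x' y' M, [/\ is_basis x' /\ is_basis y',
    forall i, (x' i).1 = (x i).1, forall l, (y' l).1 = (y l).1,
    has_matrix f x' y' M & forall i, isolated M i].
  by apply: (H _ x y M set0) => //= i; rewrite inE.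
elim: n x' y' M' P => [|n IHn] x' y' M' P Pn bx' by' xb yb hM' isoP.
  exists x', y', M'; split=> // i; apply: isoP; move: Pn.
  by rewrite leqn0 cards_eq0 => /eqP P0; rewrite -[P]setCK P0 setC0 inE.
pose Q i := (i \notin P) && [exists l, M' l i != 0].
have [i0 Qi0|Q0] := pickP Q; last first.
  exists x', y', M'; split=> // i; have [/isoP //|iP] := boolP (i \in P).
  move=> l Mli; have /negbT := Q0 i; rewrite /Q iP /= negb_exists.
  by move=> /forallP/(_ l); rewrite Mli.
(* The sum of the endpoints is monotone for [bprec], and comparable bars with equal sums
   coincide. *)
case: (@arg_minP _ _ _ i0 Q (fun i => blo (x' i).1 + bhi (x' i).1) Qi0).
move=> i /andP[iP /existsP[k Mki]] imin.
have [colmax rowmin] := ext _ _ _ bx' by' xb yb hM'.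
have [l Mli lmax] := colmax _ _ Mki; have [j Mlj jmin] := rowmin _ _ Mli.
(* The least bar of row [l] sits at an untreated column [j]; by the choice of [i] it equals the bar
   of [x' i], so [i] is a legal pivot. *)
have jP : j \notin P.
  apply: contra Mli => jP; have [_ _ Mi] := isoP _ jP _ Mlj.
  by apply/eqP/Mi; apply: contraNneq iP => ->.
have ij : (x' i).1 = (x' j).1.
  have /imin : Q j by rewrite /Q jP; apply/existsP; exists l.
  move: (jmin _ Mli) => /and3P[a _ b] /= s.
  by apply: bar_ext; apply: le_anti; apply/andP; split; lra.
have imin' i' : M' l i' != 0 -> bprec (x' i).1 (x' i').1 by rewrite ij; exact: jmin.
have [x2 [y2 [M2 [[bx2 by2] xb2 yb2 hM2 [iso2 isoP2]]]]] :=
  isolate_entry bx' by' hM' Mli lmax imin'.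
apply: (IHn x2 y2 M2 (i |: P)) => //.
- rewrite -ltnS; apply: leq_trans Pn; apply: proper_card.
  apply/properP; split; first by rewrite setCS subsetUr.
  by exists i; rewrite !inE ?eqxx ?iP.
- by move=> k'; rewrite xb2.
- by move=> k'; rewrite yb2.
- move=> k'; rewrite !inE; have [-> //|k'i /= k'P] := eqVneq k' i.
  by apply: isoP2 => //; exact: isoP.
Qed.

End Elimination.

(** * Extremal entries from interleavings *)

Section Interleavings.
Variables (R : realType) (F : fieldType).
Implicit Types (V W U Z : pfunctor R F) (I L : finType).

Definition nest_gap I (J : I -> bar R) (e : R) : Prop :=
  forall i j, bnested (J i) (J j) ->
    blo (J j) + e < blo (J i) /\ bhi (J i) + e < bhi (J j).

(* The greatest bar of a column is found by maximizing the sum of the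
   endpoints.  If it were not comparable with some other bar of the column,
   both being nested, the bar [x i] of the column would be longer than [e];
   but then [close] provides a bar of the column which is too close to [x i]
   for this. *)
Lemma column_max V U I L (x : I -> bar_gen V) (y : L -> bar_gen U) (e : R)
    (M : L -> I -> F) i k :
  nest_gap (fun l => (y l).1) e ->
  (forall l i, M l i != 0 -> bprec (y l).1 (x i).1) ->
  (blo (x i).1 + e <= bhi (x i).1 -> exists2 l, M l i != 0 &
     blo (x i).1 - e <= blo (y l).1 /\ bhi (x i).1 - e <= bhi (y l).1) ->
  M k i != 0 ->
  exists2 l, M l i != 0 & forall l', M l' i != 0 -> bprec (y l').1 (y l).1.
Proof.
move=> gap Mp close Mk.
case: (@arg_maxP _ _ _ k (fun l => M l i != 0)
         (fun l => blo (y l).1 + bhi (y l).1) Mk) => l Ml lmax.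
exists l => // l' Ml'; have {}lmax l0 M0 := lmax l0 M0 : _ <= _.
have /and3P[p1 p2 p3] := Mp _ _ Ml; have /and3P[q1 q2 q3] := Mp _ _ Ml'.
have gap' a b (P := gap a b) : blo (y b).1 < blo (y a).1 ->
    bhi (y a).1 < bhi (y b).1 -> _ := fun h1 h2 =>
    P (introT and3P (And3 h1 (blo_le_bhi _) h2)).
have lm := lmax _ Ml'.
rewrite /bprec (le_trans p1 q2) /=.
case: (leP (blo (y l').1) (blo (y l).1)) => [a|a] /=;
  case: (leP (bhi (y l').1) (bhi (y l).1)) => // b; last by lra.
  have a' : blo (y l').1 < blo (y l).1 by lra.
  have [g1 g2] := gap' _ _ a' b.
  (* [y l0] ends after [y l], hence by maximality starts before it; the resulting gap at the lower
     end contradicts closeness to [x i]. *)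
  have [|l0 M0 [c1 c2]] := close; first by lra.
  have lm0 := lmax _ M0.
  have h1 : bhi (y l).1 < bhi (y l0).1 by lra.
  have h2 : blo (y l0).1 < blo (y l).1 by lra.
  have [] := gap' _ _ h2 h1; lra.
have b' : bhi (y l').1 < bhi (y l).1 by lra.
have [g1 g2] := gap' _ _ a b'.
have [|l0 M0 [c1 c2]] := close; first by lra.
have lm0 := lmax _ M0.
have h1 : blo (y l).1 < blo (y l0).1 by lra.
have h2 : bhi (y l0).1 < bhi (y l).1 by lra.
have [] := gap' _ _ h1 h2; lra.
Qed.

(** Dual to [column_max]: minimize the sum of the endpoints, and let [close] give a bar of the row
    too near to [y l]. *)
Lemma row_min V U I L (x : I -> bar_gen V) (y : L -> bar_gen U) (e : R)
    (M : L -> I -> F) l k :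
  nest_gap (fun i => (x i).1) e ->
  (forall l i, M l i != 0 -> bprec (y l).1 (x i).1) ->
  (blo (y l).1 + e <= bhi (y l).1 -> exists2 i, M l i != 0 &
     blo (x i).1 - e <= blo (y l).1 /\ bhi (x i).1 - e <= bhi (y l).1) ->
  M l k != 0 ->
  exists2 i, M l i != 0 & forall i', M l i' != 0 -> bprec (x i).1 (x i').1.
Proof.
move=> gap Mp close Mk.
case: (@arg_minP _ _ _ k (fun i => M l i != 0)
         (fun i => blo (x i).1 + bhi (x i).1) Mk) => i Mi imin.
exists i => // i' Mi'; have {}imin i0 M0 := imin i0 M0 : _ <= _.
have /and3P[p1 p2 p3] := Mp _ _ Mi; have /and3P[q1 q2 q3] := Mp _ _ Mi'.
have gap' a b (P := gap a b) : blo (x b).1 < blo (x a).1 ->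
    bhi (x a).1 < bhi (x b).1 -> _ := fun h1 h2 =>
    P (introT and3P (And3 h1 (blo_le_bhi _) h2)).
have im := imin _ Mi'.
rewrite /bprec (le_trans q2 p3) /=.
case: (leP (blo (x i).1) (blo (x i').1)) => [a|a] /=;
  case: (leP (bhi (x i).1) (bhi (x i').1)) => // b; last by lra.
  have a' : blo (x i).1 < blo (x i').1 by lra.
  have [g1 g2] := gap' _ _ a' b.
  have [|i0 M0 [c1 c2]] := close; first by lra.
  have im0 := imin _ M0.
  have h1 : bhi (x i0).1 < bhi (x i).1 by lra.
  have h2 : blo (x i).1 < blo (x i0).1 by lra.
  have [] := gap' _ _ h2 h1; lra.
have b' : bhi (x i).1 < bhi (x i').1 by lra.
have [g1 g2] := gap' _ _ a b'.
have [|i0 M0 [c1 c2]] := close; first by lra.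
have im0 := imin _ M0.
have h1 : blo (x i0).1 < blo (x i).1 by lra.
have h2 : bhi (x i).1 < bhi (x i0).1 by lra.
have [] := gap' _ _ h1 h2; lra.
Qed.

Lemma pf_map_irrelevance V (s t : R) (h k : s <= t) v : pf_map V h v = pf_map V k v.
Proof. by rewrite (bool_irrelevance h k). Qed.

(** The interleaving sends [x i] to its shift by [d + d]. For a bar of length at least [d + d] both
    are alive at its lower end, and [matrix_comp_match] gives the close bar required by
    [column_max]; the other composite serves the rows. *)
Lemma interleaving_extremal (V W : persmod R F) (d : R) (hd : 0 <= d)
    (f : pf_hom V (pf_shift W d)) (g : pf_hom W (pf_shift V d))
    I L (x : I -> bar_gen V) (y : L -> bar_gen (pf_shift W d)) M :
  interleaving hd f g -> is_basis x -> is_basis y ->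
  nest_gap (fun i => (x i).1) (d + d) -> nest_gap (fun l => (y l).1) (d + d) ->
  has_matrix f x y M -> extremal_entries x y M.
Proof.
move=> [gf fg] bx bY gx gy hM.
pose sh Z (z : bar_gen Z) := gen_shift d (gen_shift d z).
pose x2 := sh V \o x; pose y2 := sh (pf_shift W d) \o y.
have bx2 : is_basis x2 by exact: is_basis_shift (is_basis_shift d bx).
have by2 : is_basis y2 by exact: is_basis_shift (is_basis_shift d bY).
have [N hN] := exists_matrix (shift_hom g d) bY bx2.
(* Shifting a morphism keeps its matrix, so both composites involve the same [M]. *)
have hM2 : has_matrix (shift_hom (shift_hom f d) d) x2 y2 M.
  apply: has_matrix_shift; [exact: is_basis_shift|exact: is_basis_shift|].
  exact: has_matrix_shift.
have sh_lo Z (z : bar_gen Z) : blo (sh Z z).1 = blo z.1 - (d + d).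
  by rewrite opprD addrA.
have sh_hi Z (z : bar_gen Z) : bhi (sh Z z).1 = bhi z.1 - (d + d).
  by rewrite opprD addrA.
have in_lo Z (z : bar_gen Z) : blo z.1 + (d + d) <= bhi z.1 ->
    in_bar (sh Z z).1 (blo z.1).
  by rewrite /in_bar sh_lo sh_hi => h; apply/andP; split; lra.
split=> [i k|l k] Mk.
  apply: (column_max gy hM.1 _ Mk) => xl.
  have [|||l Ml Nl] := matrix_comp_match bx bY bx2 hM hN (t := blo (x i).1) (i := i).
  - rewrite /= gf; apply: (bx.1 i).2; exact: in_bar_lo.
  - exact: in_bar_lo.
  - exact: in_lo.
  by exists l => //; move/hN.1: Nl => /and3P[+ _]; rewrite sh_lo sh_hi.
apply: (row_min gx hM.1 _ Mk) => yl.
have [|||i Ni Mi] := matrix_comp_match bY bx2 by2 hN hM2 (t := blo (y l).1) (i := l).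
- rewrite /= fg; have h : blo (y l).1 <= blo (y l).1 + d + d by exact: le_inner2.
  rewrite -((bY.1 l).2 _ _ h) ?in_bar_lo //; exact: pf_map_irrelevance.
- exact: in_bar_lo.
- exact: in_lo.
by exists i => //; move/hN.1: Ni => /and3P[+ _]; rewrite sh_lo sh_hi.
Qed.

Definition gap_gt (V : persmod R F) (e : R) : Prop :=
  {in Bar V &, forall J K, bnested J K ->
     e < `|blo J - blo K| /\ e < `|bhi J - bhi K|}.

Lemma gap_gt_nest_gap (V : persmod R F) e I (J : I -> bar R) :
  gap_gt V e -> (forall i, J i \in Bar V) -> nest_gap J e.
Proof.
move=> gV JV i j n; have [] := gV _ _ (JV i) (JV j) n.
case/and3P: n => lo _ hi.
rewrite gtr0_norm ?subr_gt0 // ltr0_norm ?subr_lt0 // opprB => a b; split; lra.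
Qed.

Lemma interleaving_reduced (V W : persmod R F) (d : R) (hd : 0 <= d)
    (f : pf_hom V (pf_shift W d)) (g : pf_hom W (pf_shift V d)) :
  interleaving hd f g -> gap_gt V (d + d) -> gap_gt W (d + d) ->
  exists n (x : 'I_n -> bar_gen V) m (y : 'I_m -> bar_gen (pf_shift W d)) M,
  [/\ is_basis x /\ is_basis y,
      [seq (x i).1 | i <- enum 'I_n] = Bar V,
      [seq (y l).1 | l <- enum 'I_m] = map (bshift d) (Bar W),
      has_matrix f x y M & forall i, isolated M i].
Proof.
move=> fg gV gW; have [B BV bB] := exists_list_basis V.
have [C CW bC] := exists_list_basis W.
have [|x [y [M [bxy xB yC hM iso]]]] :=
  reduce_matrix (f := f) bB (is_basis_shift d bC).
  move=> x y M bx bY xB yC; apply: (interleaving_extremal fg) => //.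
    by apply: (gap_gt_nest_gap gV) => i; rewrite xB -BV map_f ?mem_tnth.
  suff gap : nest_gap (fun l => (tnth (in_tuple C) l).1) (d + d).
    move=> i j; rewrite !yC => n.
    have [] := gap i j; last by rewrite /blo /bhi /= => ? ?; split; lra.
    by move: n; rewrite /bnested /blo /bhi /= ltrD2r lerD2r ltrD2r.
  by apply: (gap_gt_nest_gap gW) => l; rewrite -CW map_f ?mem_tnth.
exists _, x, _, y, M; split=> //.
  by rewrite (eq_map xB) -BV (map_comp fst) map_tnth_enum.
rewrite (eq_map yC) -CW.
transitivity (map (bshift d \o fst) (map (tnth (in_tuple C)) (enum 'I_(size C)))).
  by elim: (enum 'I__) => //= i s ->.
by rewrite map_tnth_enum map_comp.
Qed.

End Interleavings.

(** * Ladder decompositions *)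

Section Ladders.
Variables (R : realType) (F : fieldType).
Implicit Types (V W U Z : pfunctor R F) (I L : finType).

(** The chosen coordinates are arbitrary at bars missing [t]; this is harmless when [y] is a basis
    with the same bars, as [y i] vanishes there. *)
Definition transfer V W I (x : I -> bar_gen V) (bx : is_basis x) (y : I -> bar_gen W)
    t (v : V t) : W t :=
  \sum_i sval (cid ((bx.2 t).2 v)) i *: (y i).2 t.

Lemma transferE V W I (x : I -> bar_gen V) (bx : is_basis x) (y : I -> bar_gen W) :
  is_basis y -> (forall i, (y i).1 = (x i).1) -> forall t (c : I -> F),
  transfer bx y (\sum_i c i *: (x i).2 t) = \sum_i c i *: (y i).2 t.
Proof.
move=> bY xy t c; rewrite /transfer; case: cid => /= e /(is_basis_inj bx) ce.
apply: eq_bigr => i _; have [/ce -> //|] := boolP (in_bar (x i).1 t).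
by rewrite -xy => /(is_basis_vanish bY) ->; rewrite !scaler0.
Qed.

Lemma transfer_linear V W I (x : I -> bar_gen V) (bx : is_basis x)
    (y : I -> bar_gen W) :
  is_basis y -> (forall i, (y i).1 = (x i).1) -> forall t,
  linear (transfer bx y (t := t)).
Proof.
move=> bY xy t a u v; have [c ->] := (bx.2 t).2 u; have [e ->] := (bx.2 t).2 v.
rewrite scaler_sumr -big_split /=; under eq_bigr do rewrite scalerA -scalerDl.
rewrite !transferE // scaler_sumr -big_split /=.
by apply: eq_bigr => i _; rewrite scalerA -scalerDl.
Qed.

Lemma is_basis_span V I (x : I -> bar_gen V) : is_basis x -> forall t (v : V t),
  exists2 c : I -> F, v = \sum_i c i *: (x i).2 t
    & forall i, c i != 0 -> in_bar (x i).1 t.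
Proof.
move=> bx t v; have [c ->] := (bx.2 t).2 v.
exists (fun i => if in_bar (x i).1 t then c i else 0).
  apply: eq_bigr => i _; case: ifPn => // /(is_basis_vanish bx) ->.
  by rewrite !scaler0.
by move=> i; case: ifP => // _; rewrite eqxx.
Qed.

Lemma exists_hom_bases V W I (x : I -> bar_gen V) (y : I -> bar_gen W) :
  is_basis x -> is_basis y -> (forall i, (y i).1 = (x i).1) ->
  exists f : pf_hom V W, forall t (c : I -> F),
    f t (\sum_i c i *: (x i).2 t) = \sum_i c i *: (y i).2 t.
Proof.
move=> bx bY xy.
pose phi t : {linear V t -> W t} :=
  HB.pack (transfer bx y (t := t))
    (GRing.isLinear.Build F (V t) (W t) _ _ (transfer_linear bx bY xy (t := t))).
have phi_nat s t (st : s <= t) v : phi t (pf_map V st v) = pf_map W st (phi s v).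
  have [c -> cs] := is_basis_span bx v.
  have c_lo i : c i != 0 -> blo (x i).1 <= s by move/cs/andP => [].
  rewrite (is_basis_pf_map bx st) // /phi /= !transferE //.
  by rewrite (is_basis_pf_map bY st) // => i; rewrite xy; exact: c_lo.
by exists (Defs.Hom phi_nat) => t c; exact: transferE.
Qed.

Lemma exists_iso_bases V W I (x : I -> bar_gen V) (y : I -> bar_gen W) :
  is_basis x -> is_basis y -> (forall i, (y i).1 = (x i).1) ->
  exists f : pf_iso V W, forall i t, iso_fwd f t ((x i).2 t) = (y i).2 t.
Proof.
move=> bx bY xy; have [f fE] := exists_hom_bases bx bY xy.
have [g gE] := exists_hom_bases bY bx (fun i => esym (xy i)).
have fK t : cancel (f t) (g t).
  by move=> v; have [c ->] := (bx.2 t).2 v; rewrite fE gE.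
have gK t : cancel (g t) (f t).
  by move=> v; have [c ->] := (bY.2 t).2 v; rewrite gE fE.
exists (Iso fK gK) => i t /=.
have delta Z (z : I -> bar_gen Z) : (z i).2 t = \sum_j (j == i)%:R *: (z j).2 t.
  rewrite (bigD1 i) //= eqxx scale1r big1 ?addr0 // => j /negbTE ->.
  by rewrite scale0r.
by rewrite [in LHS]delta fE -delta.
Qed.

Lemma summand_dom_basis (l : ladder_summand R) :
  list_basis (summand_dom_gens F l).
Proof. by case: l => *; [exact: list_basis_kint..|exact: list_basis_pf0]. Qed.

Lemma summand_cod_basis (l : ladder_summand R) :
  list_basis (summand_cod_gens F l).
Proof.
by case: l => *; [exact: list_basis_kint|exact: list_basis_pf0|exact: list_basis_kint].
Qed.

Lemma dom_gens_basis (s : seq (ladder_summand R)) : list_basis (dom_gens F s).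
Proof.
elim: s => [|l s IHs]; first exact: list_basis_pf0.
by apply: list_basis_dsum IHs; exact: summand_dom_basis.
Qed.

Lemma cod_gens_basis (s : seq (ladder_summand R)) : list_basis (cod_gens F s).
Proof.
elim: s => [|l s IHs]; first exact: list_basis_pf0.
by apply: list_basis_dsum IHs; exact: summand_cod_basis.
Qed.

Lemma unzip1_gens_dsum V W (B : seq (bar_gen V)) (C : seq (bar_gen W)) :
  unzip1 (gens_dsum B C) = unzip1 B ++ unzip1 C.
Proof. by rewrite /unzip1 map_cat -!map_comp. Qed.

Definition bar0 : bar R := exist _ (0, 0) (lexx 0).
Definition gen0 V : bar_gen V := (bar0, fun _ => 0).

Lemma unzip1_dom_gens (l : ladder_summand R) s : unzip1 (dom_gens F (l :: s)) =
  unzip1 (summand_dom_gens F l) ++ unzip1 (dom_gens F s).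
Proof. exact: unzip1_gens_dsum. Qed.

Lemma unzip1_cod_gens (l : ladder_summand R) s : unzip1 (cod_gens F (l :: s)) =
  unzip1 (summand_cod_gens F l) ++ unzip1 (cod_gens F s).
Proof. exact: unzip1_gens_dsum. Qed.

Lemma exists_ladder_sum0 (X Y : seq (bar R)) : exists s : seq (ladder_summand R),
  [/\ unzip1 (dom_gens F s) = X, unzip1 (cod_gens F s) = Y
    & forall t v, ld_map (ladder_sum F s) t v = 0].
Proof.
elim: X => [|J X [s [sX sY s0]]]; last first.
  exists (LadIplus J :: s); rewrite unzip1_dom_gens unzip1_cod_gens sX sY.
  by split=> // t v; rewrite /= /dsum_map s0.
elim: Y => [|K Y [s [sX sY s0]]]; first by exists [::].
exists (LadIminus K :: s); rewrite unzip1_dom_gens unzip1_cod_gens sX sY.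
by split=> // t v; rewrite /= /dsum_map s0.
Qed.

(** Past the end both sides are the default generator, as [gen_inr] maps [gen0] to [gen0]. *)
Lemma nth_gen_inr V W (C : seq (bar_gen W)) k :
  nth (gen0 (dsum V W)) (map (@gen_inr R F V W) C) k = gen_inr V (nth (gen0 W) C k).
Proof.
have [kC|Ck] := ltnP k (size C); first by rewrite (nth_map (gen0 W)).
by rewrite !nth_default ?size_map.
Qed.

(** Matched pairs come first in both lists, so position [k] of the domain goes to position [k] of
    the codomain; [X] and [Y] are the unmatched bars. *)
Lemma exists_ladder_sum (P : seq (bar R * bar R)) (X Y : seq (bar R)) :
  all (fun p => bprec p.1 p.2) P ->
  exists s : seq (ladder_summand R),
  [/\ unzip1 (dom_gens F s) = map snd P ++ X,
      unzip1 (cod_gens F s) = map fst P ++ Y,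
      forall k t, (k < size P)%N -> let g := nth (gen0 _) (dom_gens F s) k in
        in_bar g.1 t ->
        ld_map (ladder_sum F s) t (g.2 t) = (nth (gen0 _) (cod_gens F s) k).2 t
    & forall k t, (size P <= k)%N ->
        ld_map (ladder_sum F s) t ((nth (gen0 _) (dom_gens F s) k).2 t) = 0].
Proof.
elim: P => [_|[J K] P IHP /= /andP[JK]].
  by have [s [sX sY s0]] := exists_ladder_sum0 X Y; exists s.
case/IHP => s [sX sY sP s0]; exists (LadR JK :: s).
rewrite unzip1_dom_gens unzip1_cod_gens sX sY; split=> // [[|k] t|[//|k] t] /=.
- move=> _ Kt; rewrite /dsum_map /= linear0; congr pair.
  rewrite Kt; case: (in_bar J t); first by rewrite pid_mx_1 mulmx1.
  by rewrite !thinmx0.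
- rewrite ltnS !nth_gen_inr /= => kP kt.
  by rewrite /dsum_map /= mul0mx sP.
- by rewrite ltnS nth_gen_inr /= => Pk; rewrite /dsum_map /= mul0mx s0.
Qed.

(** Nonzero entries become [LadR], zero columns [LadIplus], zero rows [LadIminus]; the bases,
    reordered with matched pairs first, are sent to the standard generators. *)
Lemma reduced_ladder V U (f : pf_hom V U) I L (x : I -> bar_gen V)
    (y : L -> bar_gen U) M :
  is_basis x -> is_basis y -> has_matrix f x y M -> (forall i, isolated M i) ->
  exists (D : ladder_decomposition f) B C, [/\ obtained_in D B C,
    list_basis B /\ list_basis C,
    perm_eq (unzip1 B) [seq (x i).1 | i <- enum I]
    & perm_eq (unzip1 C) [seq (y l).1 | l <- enum L]].
Proof.
move=> bx bY hM iso.
pose P := [seq p <- enum {: L * I} | M p.1 p.2 != 0].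
pose X := [seq i <- enum I | ~~ [exists l, M l i != 0]].
pose Y := [seq l <- enum L | ~~ [exists i, M l i != 0]].
have memP p : (p \in P) = (M p.1 p.2 != 0) by rewrite mem_filter mem_enum andbT.
have memX i : (i \in X) = ~~ [exists l, M l i != 0].
  by rewrite mem_filter mem_enum andbT.
have memY l : (l \in Y) = ~~ [exists i, M l i != 0].
  by rewrite mem_filter mem_enum andbT.
have uP : uniq P by rewrite filter_uniq ?enum_uniq.
(* Isolation gives each column at most one entry, so no index repeats among the second components of
   [P]. *)
have pX : perm_eq (map snd P ++ X) (enum I).
  apply: uniq_perm; rewrite ?enum_uniq //.
    rewrite cat_uniq filter_uniq ?enum_uniq // andbT map_inj_in_uniq ?uP /=.
      apply/hasPn => i; rewrite memX; apply: contra => /mapP[[l j]].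
      by rewrite memP /= => Mlj ->; apply/existsP; exists l.
    move=> [l i] [l' i']; rewrite !memP /= => Mli + ii; rewrite -ii => Ml'i.
    have [_ M0 _] := iso _ _ Mli; have [-> //|ll] := eqVneq l l'.
    by move: Ml'i; rewrite M0 ?eqxx // eq_sym.
  move=> i; rewrite mem_enum mem_cat memX; apply/orP.
  have [/existsP[l Mli]|] := boolP [exists l, M l i != 0]; last by right.
  by left; apply/mapP; exists (l, i); rewrite ?memP.
have pY : perm_eq (map fst P ++ Y) (enum L).
  apply: uniq_perm; rewrite ?enum_uniq //.
    rewrite cat_uniq filter_uniq ?enum_uniq // andbT map_inj_in_uniq ?uP /=.
      apply/hasPn => l; rewrite memY; apply: contra => /mapP[[k i]].
      by rewrite memP /= => Mlj ->; apply/existsP; exists i.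
    move=> [l i] [l' i']; rewrite !memP /= => Mli + ll; rewrite -ll => Mli'.
    have [_ _ M0] := iso _ _ Mli; have [-> //|ii] := eqVneq i i'.
    by move: Mli'; rewrite M0 ?eqxx // eq_sym.
  move=> l; rewrite mem_enum mem_cat memY; apply/orP.
  have [/existsP[i Mli]|] := boolP [exists i, M l i != 0]; last by right.
  by left; apply/mapP; exists (l, i); rewrite ?memP.
have [|s [sX sY sP s0]] := @exists_ladder_sum
    [seq ((y p.1).1, (x p.2).1) | p <- P] [seq (x i).1 | i <- X]
    [seq (y l).1 | l <- Y].
  by rewrite all_map; apply/allP => p; rewrite memP => /hM.1.
have {}sX : unzip1 (dom_gens F s) = [seq (x i).1 | i <- map snd P ++ X].
  by rewrite sX map_cat -!map_comp.
have {}sY : unzip1 (cod_gens F s) = [seq (y l).1 | l <- map fst P ++ Y].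
  by rewrite sY map_cat -!map_comp.
rewrite size_map in sP s0.
have eX : size (dom_gens F s) = size (map snd P ++ X).
  by rewrite -(size_map fst) -/(unzip1 _) sX size_map.
have eY : size (cod_gens F s) = size (map fst P ++ Y).
  by rewrite -(size_map fst) -/(unzip1 _) sY size_map.
pose hX i := tnth (in_tuple (map snd P ++ X)) (cast_ord eX i).
pose hY l := tnth (in_tuple (map fst P ++ Y)) (cast_ord eY l).
have bxX : is_basis (x \o hX).
  by apply: is_basis_reindex => //; exact: tnth_perm_enum_bij.
have byY : is_basis (y \o hY).
  by apply: is_basis_reindex => //; exact: tnth_perm_enum_bij.
have domX i : (nth (gen0 _) (dom_gens F s) (i : 'I__)).1 = (x (hX i)).1.
  rewrite -(nth_map _ bar0) //= -/(unzip1 _) sX.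
  by rewrite (nth_map (hX i)) -?eX // /hX [in RHS](tnth_nth (hX i)).
have codY l : (nth (gen0 _) (cod_gens F s) (l : 'I__)).1 = (y (hY l)).1.
  rewrite -(nth_map _ bar0) //= -/(unzip1 _) sY.
  by rewrite (nth_map (hY l)) -?eY // /hY [in RHS](tnth_nth (hY l)).
have [u uE] : exists u : pf_iso V (ld_dom (ladder_sum F s)), forall i t,
    iso_fwd u t ((x (hX i)).2 t) = (tnth (in_tuple (dom_gens F s)) i).2 t.
  apply: (exists_iso_bases bxX (dom_gens_basis s)) => i.
  by rewrite (tnth_nth (gen0 _)) domX.
have [w wE] : exists w : pf_iso U (ld_cod (ladder_sum F s)), forall l t,
    iso_fwd w t ((y (hY l)).2 t) = (tnth (in_tuple (cod_gens F s)) l).2 t.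
  apply: (exists_iso_bases byY (cod_gens_basis s)) => l.
  by rewrite (tnth_nth (gen0 _)) codY.
have comm t v : iso_fwd w t (f t v) = ld_map (ladder_sum F s) t (iso_fwd u t v).
  have [c ->] := (bxX.2 t).2 v; rewrite !linear_sum; apply: eq_bigr => i _.
  rewrite !linearZ /= uE; congr (_ *: _).
  have [xt|xt] := boolP (in_bar (x (hX i)).1 t); last first.
    by rewrite -uE (is_basis_vanish bx) // !linear0.
  rewrite (has_matrixE bx bY hM) // (tnth_nth (gen0 _)) /=.
  (* Below [size P] the column has the single entry 1 of its pair; from there on it is zero. *)
  have [iP|Pi] := ltnP i (size P); last first.
    rewrite s0 // big1 ?linear0 // => l _.
    suff /existsPn/(_ l) : ~~ [exists l, M l (hX i) != 0].
      by rewrite negbK => /eqP ->; rewrite scale0r.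
    rewrite -memX /hX (tnth_nth (hX i)) /= nth_cat size_map ltnNge Pi /=.
    by rewrite mem_nth // -subSn // leq_subLR -(size_map snd P) -size_cat -eX.
  pose p := tnth (in_tuple P) (Ordinal iP).
  have iY : (i < size (cod_gens F s))%N.
    by rewrite eY size_cat size_map ltn_addr.
  have hXi : hX i = p.2.
    rewrite /hX (tnth_nth p.2) /= nth_cat size_map iP (nth_map p) //.
    by rewrite /p [in RHS](tnth_nth p).
  have hYi : hY (Ordinal iY) = p.1.
    rewrite /hY (tnth_nth p.1) /= nth_cat size_map iP (nth_map p) //.
    by rewrite /p [in RHS](tnth_nth p).
  have Mp : M p.1 p.2 != 0 by rewrite -memP mem_tnth.
  have [M1 M0 _] := iso _ _ Mp.
  rewrite hXi (bigD1 p.1) //= M1 scale1r big1 ?addr0 => [|l /M0 ->]; last first.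
    by rewrite scale0r.
  rewrite sP ?domX //.
  by rewrite -hYi wE (tnth_nth (gen0 _)).
pose D := @LadderDec R F V U f s (@LadderIso R F (Ladder f) _ u w comm).
exists D, (map (gen_push (iso_bwd u)) (dom_gens F s)),
  (map (gen_push (iso_bwd w)) (cod_gens F s)); split=> //.
- split; [apply: (list_basis_iso (iso_sym u)) | apply: (list_basis_iso (iso_sym w))].
    exact: dom_gens_basis.
  exact: cod_gens_basis.
- rewrite {1}/unzip1 -map_comp -/(unzip1 (dom_gens F s)) sX; exact: perm_map.
- rewrite {1}/unzip1 -map_comp -/(unzip1 (cod_gens F s)) sY; exact: perm_map.
Qed.

End Ladders.

(** * Truncated interleavings *)

Section Truncations.
Variables (R : realType) (F : fieldType).

(** The reduced basis of the codomain is unshifted, so that [BW] is a barcode basis of [W]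
    itself. *)
Lemma interleaving_ladder (V W : persmod R F) (d : R) (hd : 0 <= d)
    (f : pf_hom V (pf_shift W d)) (g : pf_hom W (pf_shift V d)) :
  interleaving hd f g -> gap_gt V (d + d) -> gap_gt W (d + d) ->
  exists (D : ladder_decomposition f) (BV : seq (bar_gen V)) (BW : seq (bar_gen W)),
    [/\ barcode_basis BV, barcode_basis BW
      & obtained_in D BV (map (@gen_shift R F W d) BW)].
Proof.
move=> fg gV gW.
have [n [x [m [y [M [[bx bY] xV yW hM iso]]]]]] := interleaving_reduced fg gV gW.
have [D [B [C [DBC [bB bC] Bx Cy]]]] := reduced_ladder bx bY hM iso.
exists D, B, (map (@gen_unshift R F W d) C); split.
- by apply/barcode_basisE; rewrite -xV.
- apply/barcode_basisE; split.
    rewrite {1}/unzip1 -map_comp (map_comp (bshift (- d)) fst).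
    apply: perm_trans (perm_map _ Cy) _; rewrite yW -map_comp map_id_in // => J _.
    by apply: bar_ext; rewrite /blo /bhi /= /blo /bhi /= opprK subrK.
  apply: list_basis_lists (is_basis_unshift bC).
  by apply: lists_map; exact: lists_tnth.
- by rewrite -map_comp (eq_map (@gen_unshiftK R F W d)) map_id.
Qed.

Lemma interleaving_sym (V W : persmod R F) (d : R) (hd : 0 <= d)
    (f : pf_hom V (pf_shift W d)) (g : pf_hom W (pf_shift V d)) :
  interleaving hd f g -> interleaving hd g f.
Proof. by case. Qed.

Lemma pf_map_trans (V : pfunctor R F) (s t u : R) (st : s <= t) (tu : t <= u) v :
  pf_map V tu (pf_map V st v) = pf_map V (le_trans st tu) v.
Proof. exact: esym (pf_comp st tu _ v). Qed.

Lemma hom_shift_nat (V W : pfunctor R F) d (f : pf_hom V (pf_shift W d)) (s t : R)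
    (st : s <= t) v : f t (pf_map V st v) = pf_map W (le_shift d st) (f s v).
Proof. exact: hom_nat. Qed.

Section Splitting.
Variables (V : persmod R F) (q : R) (S : qsplitting V q).

Lemma sp_inK t : cancel (sp_in S t) (sp_pr S t).
Proof. by move=> v; rewrite /= iso_bwdK. Qed.

(** The two sides differ by the image of the short part, whose generators alive at [s] have died by
    [s + q]. *)
Lemma sp_in_pr (s t : R) (st : s <= t) v : s + q <= t ->
  pf_map V st (sp_in S s (sp_pr S s v)) = pf_map V st v.
Proof.
move=> sqt; rewrite -[in RHS](iso_fwdK (sp_iso S) v) /=.
apply: etrans (esym (hom_nat (iso_bwd (sp_iso S)) st _)) _.
apply: etrans _ (hom_nat (iso_bwd (sp_iso S)) st _); congr (iso_bwd _ _ _).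
case: (iso_fwd _ _ v) => a b; rewrite /inl_map /= /dsum_map /=; congr pair.
rewrite linear0; have [C CS bC] := exists_list_basis (sp_lt S).
have [c -> cs] := is_basis_span bC b; rewrite (is_basis_pf_map bC); last first.
  by move=> i /cs/andP[].
rewrite big1 // => i _; have [->|/cs/andP[xs _]] := eqVneq (c i) 0.
  by rewrite scale0r.
rewrite (is_basis_vanish bC) ?scaler0 // negb_and -!ltNge; apply/orP; right.
have := @sp_ltP _ _ _ _ S (tnth (in_tuple C) i).1.
rewrite -CS map_f ?mem_tnth // => /(_ isT); rewrite /blen.
have := blo_le_bhi (tnth (in_tuple C) i).1; lra.
Qed.

End Splitting.

Section Truncation.
Variables (V W : persmod R F) (delta : R) (Phi : pf_hom V (pf_shift W delta)).
Variables (q : R) (hq : 0 <= q).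

(** With [pre_trunc], gives the first two morphisms of the theorem in a form that also applies to
    [Psi], with [V] and [W] exchanged. *)
Definition post_trunc (SW : qsplitting W q) :
    pf_hom V (pf_shift (sp_ge SW) (delta + q / 2)) :=
  hom_comp (shift_shift (sp_ge SW) (addrC (q / 2) delta))
    (hom_comp (shift_hom (sp_phi hq SW) delta) Phi).

Definition pre_trunc (SV : qsplitting V q) :
    pf_hom (sp_ge SV) (pf_shift W (delta + q / 2)) :=
  hom_comp (shift_shift W (erefl (delta + q / 2)))
    (hom_comp (shift_hom Phi (q / 2)) (sp_phit hq SV)).

Lemma trunc_le t : t + delta <= t + (delta + q / 2).
Proof. by rewrite addrA lerDl half_ge0. Qed.

Lemma post_truncE SW t v :
  post_trunc SW t v = pf_map (sp_ge SW) (trunc_le t) (sp_pr SW _ (Phi t v)).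
Proof. by rewrite /= pf_map_trans; exact: pf_map_irrelevance. Qed.

Lemma pre_truncE SV t v :
  pre_trunc SV t v = pf_map W (trunc_le t) (Phi t (sp_in SV t v)).
Proof.
rewrite /pre_trunc /= -[inl_map _ _]/(dsum_inl _ _ _ _).
rewrite -[iso_bwd _ _ _]/(sp_in SV _ _) hom_nat hom_shift_nat pf_map_trans.
exact: pf_map_irrelevance.
Qed.

End Truncation.

(** The truncation of [Phi] after it is paired with the truncation of [Psi] before it. One composite
    passes through [sp_in] after [sp_pr], absorbed by a shift of [q]; the other through [sp_pr]
    after [sp_in], an identity. *)
Lemma interleaving_trunc (V W : persmod R F) (delta : R) (hdelta : 0 <= delta)
    (Phi : pf_hom V (pf_shift W delta)) (Psi : pf_hom W (pf_shift V delta))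
    (q : R) (hq : 0 <= q) (hd : 0 <= delta + q / 2) (SW : qsplitting W q) :
  interleaving hdelta Phi Psi ->
  interleaving hd (post_trunc Phi hq SW) (pre_trunc Psi hq SW).
Proof.
move=> [PsiPhi PhiPsi]; split=> [t v|t w].
  rewrite pre_truncE post_truncE hom_nat hom_shift_nat pf_map_trans.
  set z := Phi t v.
  (* Naturality gathers both shifts by [q / 2] between [Phi] and [Psi], which makes [sp_in_pr]
     applicable. *)
  have le1 : t + delta <= t + delta + q by rewrite lerDl.
  have le2 : t + delta + q + delta <= t + (delta + q / 2) + (delta + q / 2) by lra.
  rewrite (pf_comp (le_shift delta le1) le2) -hom_shift_nat sp_in_pr // hom_shift_nat.
  rewrite pf_map_trans PsiPhi pf_map_trans.
  congr (pf_map V _ v); exact: bool_irrelevance.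
rewrite post_truncE pre_truncE hom_shift_nat PhiPsi pf_map_trans hom_nat sp_inK.
by rewrite pf_map_trans; congr (pf_map _ _ w); exact: bool_irrelevance.
Qed.

(** Each composite is an inner morphism from [interleaving_trunc] placed between [sp_in] and
    [sp_pr], which cancel. *)
Lemma interleaving_trunc_ge (V W : persmod R F) (delta : R) (hdelta : 0 <= delta)
    (Phi : pf_hom V (pf_shift W delta)) (Psi : pf_hom W (pf_shift V delta))
    (q : R) (hq : 0 <= q) (hd : 0 <= delta + q / 2)
    (SV : qsplitting V q) (SW : qsplitting W q) :
  interleaving hdelta Phi Psi ->
  interleaving hd (hom_comp (post_trunc Phi hq SW) (sp_in SV))
    (hom_comp (post_trunc Psi hq SV) (sp_in SW)).
Proof.
have half (V' W' : persmod R F) (Phi' : pf_hom V' (pf_shift W' delta))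
    (Psi' : pf_hom W' (pf_shift V' delta)) (SV' : qsplitting V' q)
    (SW' : qsplitting W' q) t v : interleaving hdelta Phi' Psi' ->
    post_trunc Psi' hq SV' _ (sp_in SW' _ (post_trunc Phi' hq SW' t (sp_in SV' t v))) =
    pf_map (sp_ge SV') (le_inner2 hd t) v.
  move=> /(interleaving_trunc hq hd SW')[e _].
  rewrite post_truncE -hom_nat; have := e t (sp_in SV' t v).
  by rewrite pre_truncE => ->; rewrite hom_nat sp_inK.
by move=> PhiPsi; split=> t v; [exact: half | apply: half; exact: interleaving_sym].
Qed.

Lemma nestedness_le (V : persmod R F) J K :
  J \in Bar V -> K \in Bar V -> bnested J K ->
  (nestedness V <= (Num.min `|blo J - blo K| `|bhi J - bhi K|)%:E)%E.
Proof.
move=> JV KV JK; apply: (@bigmin_inf_seq _ _ _ _ _ J) => //.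
exact: (@ge_bigmin_seq _ _ _ _ _ K).
Qed.

Lemma gap_gt_nestedness (V : persmod R F) (delta q : R) (X : \bar R) :
  (delta%:E < (2^-1)%:E * X - (q / 2)%:E)%E -> (X <= nestedness V)%E ->
  gap_gt V (delta + q / 2 + (delta + q / 2)).
Proof.
move=> dX XV J K JV KV JK; apply/andP; rewrite -lt_min.
have := le_trans XV (nestedness_le JV KV JK); set m := Num.min _ _.
(* A nested pair bounds [X] by a finite number, excluding [+oo]; [-oo] contradicts the bound on
   [delta]. *)
case: X dX {XV} => [r|//|] /=; last by rewrite mulrNy gtr0_sg ?invr_gt0 // mul1e.
by rewrite -EFinM -EFinB lte_fin lee_fin => ? ?; lra.
Qed.

End Truncations.

Theorem theorem4p6 (R : realType) (F : fieldType) (V W : persmod R F)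
  (delta : R) (hdelta : 0 <= delta)
  (Phi : pf_hom V (pf_shift W delta))
  (hPhi : exists Psi : pf_hom W (pf_shift V delta), interleaving hdelta Phi Psi)
  (q : R) (hq : 0 <= q) (SV : qsplitting V q) (SW : qsplitting W q) :
  let Phi1 : pf_hom V (pf_shift (sp_ge SW) (delta + q / 2)) :=
    hom_comp (shift_shift (sp_ge SW) (addrC (q / 2) delta))
      (hom_comp (shift_hom (sp_phi hq SW) delta) Phi) in
  let Phi2 : pf_hom (sp_ge SV) (pf_shift W (delta + q / 2)) :=
    hom_comp (shift_shift W (erefl (delta + q / 2)))
      (hom_comp (shift_hom Phi (q / 2)) (sp_phit hq SV)) in
  let Phi3 : pf_hom (sp_ge SV) (pf_shift (sp_ge SW) (delta + q / 2)) :=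
    hom_comp Phi1 (sp_in SV) in
  [/\ (delta%:E < (2^-1)%:E * mine (nestedness V) (nestedness (sp_ge SW))
                    - (q / 2)%:E)%E ->
      exists (D : ladder_decomposition Phi1)
             (BV : seq (bar_gen V)) (BW : seq (bar_gen (sp_ge SW))),
        [/\ barcode_basis BV, barcode_basis BW,
            obtained_in D BV (map (@gen_shift R F (sp_ge SW) (delta + q / 2)) BW)
          & extends_to_basis BW],
      (delta%:E < (2^-1)%:E * mine (nestedness (sp_ge SV)) (nestedness W)
                    - (q / 2)%:E)%E ->
      exists (D : ladder_decomposition Phi2)
             (BV : seq (bar_gen (sp_ge SV))) (BW : seq (bar_gen W)),
        [/\ barcode_basis BV, barcode_basis BW,
            obtained_in D BV (map (@gen_shift R F W (delta + q / 2)) BW)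
          & extends_to_basis BV]
    & (delta%:E < (2^-1)%:E * mine (nestedness (sp_ge SV)) (nestedness (sp_ge SW))
                    - (q / 2)%:E)%E ->
      exists (D : ladder_decomposition Phi3)
             (BV : seq (bar_gen (sp_ge SV))) (BW : seq (bar_gen (sp_ge SW))),
        [/\ barcode_basis BV, barcode_basis BW,
            obtained_in D BV (map (@gen_shift R F (sp_ge SW) (delta + q / 2)) BW),
            extends_to_basis BV & extends_to_basis BW]].
Proof.
move=> Phi1 Phi2 Phi3; case: hPhi => Psi PhiPsi.
have hd : 0 <= delta + q / 2 by rewrite addr_ge0 ?half_ge0.
split=> dlt.
- have [||D [BV [BW [bV bW DB]]]] := interleaving_ladder (interleaving_trunc hq hd SW PhiPsi).
  + by apply: gap_gt_nestedness dlt _; rewrite ge_min lexx.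
  + by apply: gap_gt_nestedness dlt _; rewrite ge_min lexx orbT.
  by exists D, BV, BW; split=> //; exact: barcode_basis_extends.
(* Truncating [Psi] after it, with [V] and [W] exchanged, makes [Phi2] the reverse morphism of the
   pair. *)
- have [||D [BV [BW [bV bW DB]]]] := interleaving_ladder
    (interleaving_sym (interleaving_trunc hq hd SV (interleaving_sym PhiPsi))).
  + by apply: gap_gt_nestedness dlt _; rewrite ge_min lexx.
  + by apply: gap_gt_nestedness dlt _; rewrite ge_min lexx orbT.
  by exists D, BV, BW; split=> //; exact: barcode_basis_extends.
have [||D [BV [BW [bV bW DB]]]] :=
  interleaving_ladder (interleaving_trunc_ge hq hd SV SW PhiPsi).
- by apply: gap_gt_nestedness dlt _; rewrite ge_min lexx.
- by apply: gap_gt_nestedness dlt _; rewrite ge_min lexx orbT.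
by exists D, BV, BW; split=> //; exact: barcode_basis_extends.
Qed.
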